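(* For any even $m\ge 4$, with $n=2^m-1$, the coset graphs $\Gamma_{0,1}$ and $\Gamma_{1,2}$ (each with $2^{m+1}$ vertices) and $\Gamma^*_{1,2}$ (with $2^{m+2}$ vertices) are imprimitive, antipodal, distance transitive graphs. Specifically: \begin{itemize} \item $\Gamma_{0,1}$ has intersection array $\bigl(n,\tfrac{n-3}{2},1;\,1,\tfrac{n-3}{2},n\bigr)$; \item $\Gamma_{1,2}$ has intersection array $\bigl(n,\tfrac{n+1}{2},1;\,1,\tfrac{n+1}{2},n\bigr)$; \item $\Gamma^*_{1,2}$ has intersection array $\bigl(n+1,n,\tfrac{n+1}{2},1;\,1,\tfrac{n+1}{2},n,n+1\bigr)$; \item the graphs $\Gamma_{0,1}$ and $\Gamma_{1,2}$ are $Q$-polynomial. \end{itemize}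
   Context: $\mathbb{F}_2$ is the binary field. Let $\alpha$ be a primitive element of $GF(2^m)$ and let $H_m$ be the $m\times n$ binary matrix whose $i$-th column $\mathbf{h}_i$ ($i=0,\dots,n-1$) is the coordinate vector of $\alpha^i$ with respect to the basis $1,\alpha,\dots,\alpha^{m-1}$ (so the columns are exactly the nonzero vectors of $\mathbb{F}_2^m$; $H_m$ is a parity check matrix of the Hamming code). For distinct $i_1,i_2\in\{0,1,2,3\}$, $\mathbf{v}_{i_1,i_2}=(v_0,\dots,v_{n-1})$ has $v_i=1$ iff the Hamming weight $\mathrm{wt}(\mathbf{h}_i)\equiv i_1$ or $i_2\pmod 4$; $\mathcal{C}_{i_1,i_2}$ is the binary code with parity check matrix $H_m$ with the row $\mathbf{v}_{i_1,i_2}$ appended, and $\mathcal{C}^*_{i_1,i_2}$ is its extension by an overall parity check coordinate. The coset graph $\Gamma_C$ of a binary linear code $C$ has the cosets $C+\mathbf{x}$ as vertices, two cosets being adjacent iff they contain vectors at Hamming distance 1. $\Gamma_{i_1,i_2}$ and $\Gamma^*_{i_1,i_2}$ denote the coset graphs of $\mathcal{C}_{i_1,i_2}$ and $\mathcal{C}^*_{i_1,i_2}$ respectively. A connected graph of diameter $\rho$ is distance regular with intersection array $(b_0,\dots,b_{\rho-1};c_1,\dots,c_\rho)$ if it is regular and for any vertices $\gamma,\delta$ at distance $i$, $\delta$ has exactly $c_i$ neighbors at distance $i-1$ from $\gamma$ and $b_i$ neighbors at distance $i+1$ from $\gamma$; it is distance transitive if for any two pairs of vertices at the same distance some graph automorphism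 maps one pair to the other. A graph of diameter $\rho$ is primitive if it and all its distance-$i$ graphs $\Gamma_i$ ($i=1,\dots,\rho$; same vertices, edges between vertices at distance $i$) are connected, and imprimitive otherwise. A distance regular graph of diameter $\rho$ is antipodal if the relation ''equal or at distance $\rho$'' is an equivalence relation on its vertices. $Q$-polynomial is in the standard sense of distance regular graphs. *)

(* Defs.v *)
From HB Require Import structures.
From mathcomp Require Import all_boot all_order all_algebra all_fingroup all_field.
From mathcomp Require Import reals.
Set Implicit Arguments.
Unset Strict Implicit.
Unset Printing Implicit Defensive.
Import GRing.Theory.
Local Open Scope ring_scope.

Section Graphs.
Variables (T : finType) (e : rel T).

Definition simple_graph : Prop := symmetric e /\ irreflexive e.

Definition connected (r : rel T) : Prop := forall x y, connect r x y.

Definition walk (k : nat) (x y : T) : bool :=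
  [exists p : k.-tuple T, path e x p && (last x p == y)].

(* Equal to #|T| when no walk joins x to y: a shortest walk has fewer than    *)
(* #|T| steps.                                                                *)
Definition gdist (x y : T) : nat :=
  find (fun k => walk k x y) (iota 0 #|T|).

Definition diameter : nat := \max_(p : T * T) gdist p.1 p.2.

Definition regular : Prop := exists k : nat, forall x, #|[set y | e x y]| = k.

(* b = [:: b_0; ...; b_(rho-1)] and c = [:: c_1; ...; c_rho], completed by    *)
(* c_0 = 0 and b_rho = 0.                                                     *)
Definition distance_regular_with (b c : seq nat) : Prop :=
  [/\ simple_graph, connected e, diameter = size b, diameter = size c &
      regular /\
      forall x y,
        #|[set z | e y z & (gdist x z).+1 == gdist x y]|
          = nth 0%N (0%N :: c) (gdist x y) /\
        #|[set z | e y z & gdist x z == (gdist x y).+1]|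
          = nth 0%N b (gdist x y)].

Definition automorphism (g : {perm T}) : Prop :=
  forall x y, e (g x) (g y) = e x y.

Definition distance_transitive : Prop :=
  forall x y x' y', gdist x y = gdist x' y' ->
    exists g : {perm T}, [/\ automorphism g, g x = x' & g y = y'].

Definition distance_graph (i : nat) : rel T := fun x y => gdist x y == i.

Definition primitive : Prop :=
  connected e /\
  forall i, (1 <= i <= diameter)%N -> connected (distance_graph i).

Definition imprimitive : Prop := ~ primitive.

Definition antipodal : Prop :=
  equivalence_rel (fun x y : T => (x == y) || (gdist x y == diameter)).

Section QPolynomial.
Variable R : fieldType.

Definition distance_mx (i : nat) : 'M[R]_#|T| :=
  \matrix_(x, y) (gdist (enum_val x) (enum_val y) == i)%:R.

Definition in_bose_mesner (M : 'M[R]_#|T|) : Prop :=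
  exists a : 'I_diameter.+1 -> R, M = \sum_i a i *: distance_mx i.

Definition primitive_idempotent (E : 'M[R]_#|T|) : Prop :=
  [/\ in_bose_mesner E, E != 0, E *m E = E &
      forall F : 'M[R]_#|T|, in_bose_mesner F -> F *m F = F -> F *m E = F ->
        F = 0 \/ F = E].

(* Some ordering E_0 = J / |X|, E_1, ..., E_d of all the primitive            *)
(* idempotents of the Bose-Mesner algebra satisfies |X| E_j = q_j(|X| E_1),   *)
(* q_j being a polynomial of degree j applied entrywise.                      *)
Definition Q_polynomial : Prop :=
  exists (E : 'I_diameter.+1 -> 'M[R]_#|T|) (q : 'I_diameter.+1 -> {poly R}),
    [/\ injective E,
        forall M, primitive_idempotent M <-> exists j, M = E j,
        E ord0 = const_mx (#|T|%:R^-1) &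
        forall j, size (q j) = j.+1 /\
          #|T|%:R *: E j
            = map_mx (fun z => (q j).[z]) (#|T|%:R *: E (inord 1))].

End QPolynomial.
End Graphs.

Section Codes.
Variable N : nat.
Implicit Types (x y : 'rV['F_2]_N) (C : {set 'rV['F_2]_N}).

Definition hamming_dist x y : nat := #|[set i | x 0 i != y 0 i]|.

Definition code_of_parity_check r (H : 'M['F_2]_(r, N)) : {set 'rV['F_2]_N} :=
  [set x | H *m x^T == 0].

Definition extended_code C : {set 'rV['F_2]_(N + 1)} :=
  [set row_mx c (\sum_i c 0 i)%:M | c in C].

Definition cosets C : {set {set 'rV['F_2]_N}} :=
  [set [set c + x | c in C] | x : 'rV['F_2]_N].

Definition coset_graph C : rel {A : {set 'rV['F_2]_N} | A \in cosets C} :=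
  fun A B => [exists x in val A, exists y in val B, hamming_dist x y == 1%N].

End Codes.

Section Construction.
Variables (m : nat) (L : fieldExtType 'F_2) (alpha : L).

Definition power_basis : m.-tuple L := [tuple alpha ^+ j | j < m].

Definition hamming_mx : 'M['F_2]_(m, 2 ^ m - 1) :=
  \matrix_(r, i) coord power_basis r (alpha ^+ i).

Definition col_weight (i : 'I_(2 ^ m - 1)) : nat :=
  #|[set r | hamming_mx r i != 0]|.

Definition v_row (i1 i2 : nat) : 'rV['F_2]_(2 ^ m - 1) :=
  \row_i ((col_weight i == i1 %[mod 4]) || (col_weight i == i2 %[mod 4]))%:R.

Definition code_C (i1 i2 : nat) : {set 'rV['F_2]_(2 ^ m - 1)} :=
  code_of_parity_check (col_mx hamming_mx (v_row i1 i2)).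

Definition code_Cstar (i1 i2 : nat) : {set 'rV['F_2]_(2 ^ m - 1 + 1)} :=
  extended_code (code_C i1 i2).

Definition Gamma (i1 i2 : nat) := @coset_graph _ (code_C i1 i2).
Definition Gamma_star (i1 i2 : nat) := @coset_graph _ (code_Cstar i1 i2).

End Construction.

Arguments coset_graph {N} C.
Arguments Gamma m {L} alpha i1 i2.
Arguments Gamma_star m {L} alpha i1 i2.

(* Main.v *)
Require Import Defs.
From HB Require Import structures.
From mathcomp Require Import all_boot all_order all_algebra all_fingroup all_field.
From mathcomp Require Import reals.
From mathcomp Require Import ring lra.

(** Modulo 4 the weight of x is e1(x) + 2 e2(x), with e1 and e2 the elementary
    symmetric polynomials mod 2. Hence the indicator f of the weight classes
    {1, 2} (resp. {0, 1}) is the quadratic function e1 + e2 (resp. 1 + e2), and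
    f(x + y) = f(x) + f(y) + B(x, y) + eps with eps = 0 (resp. 1) and
    B(x, y) = e1(x) e1(y) + x . y, an alternating form that is nondegenerate
    because m is even.

    A coset is determined by its syndrome (x, a), and two cosets are adjacent
    iff their syndromes differ by a column of the parity check matrix. After
    the change of variable a -> a + f(x), adjacency in Gamma_{0,1} and
    Gamma_{1,2} reads x <> y and a + b = B(x, y) + eps: the symplectic double
    cover of the complete graph on F_2^m. In Gamma*_{1,2} it reads p <> q and
    a + b = B(x, y), the Hadamard graph of the matrix ((-1)^B(x, y)). Distances
    are explicit in both graphs, and translations together with symplectic
    transvections make them distance transitive.

    For the Q-polynomial property, the Bose-Mesner algebra of the double cover
    is spanned by J, K = A_0 + A_3, D = A_0 - A_3 and the signed matrix
    S = ((-1)^(a + b + B(x, y))). Since S^2 = 2^(m+1) D and 2^m is the square of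
    s = 2^(m/2), the primitive idempotents are J / 2^(m+1), (D + S/s) / 4,
    K/2 - J / 2^(m+1) and (D - S/s) / 4, in a Q-polynomial order. *)

Set Implicit Arguments.
Unset Strict Implicit.
Unset Printing Implicit Defensive.
Import Order.TTheory GRing.Theory Num.Theory.

(** * Recognising the path metric of a graph *)

Section Distance.
Variables (T : finType) (e : rel T).

Lemma walk0 x y : walk e 0 x y = (x == y).
Proof.
apply/existsP/eqP => [[p]|->]; last by exists [tuple]; rewrite /= eqxx.
by rewrite [p]tuple0 /= => /eqP.
Qed.

Lemma walkS k x y : walk e k.+1 x y = [exists z, walk e k x z && e z y].
Proof.
apply/existsP/existsP => [[[p sp] /=]|[z /andP[/existsP[p]]]].
  case/lastP: p sp => [//|p w] sp.
  rewrite rcons_path last_rcons => /andP[/andP[ep ew] /eqP ewy].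
  have sp' : size p == k by move: sp; rewrite size_rcons eqSS.
  exists (last x p); rewrite -ewy ew andbT; apply/existsP.
  by exists (Tuple sp'); rewrite /= ep eqxx.
move=> /andP[ep /eqP lp] ezy.
have sp : size (rcons p y) == k.+1 by rewrite size_rcons size_tuple.
by exists (Tuple sp); rewrite /= rcons_path ep last_rcons lp ezy eqxx.
Qed.

Lemma walk_connect k x y : walk e k x y -> connect e x y.
Proof.
case/existsP=> p /andP[ep /eqP lp]; apply/connectP.
by exists (val p).
Qed.

(* These four conditions determine the path metric. *)
Variable d : T -> T -> nat.
Hypothesis d_lt : forall x y, (d x y < #|T|)%N.
Hypothesis d0 : forall x y, (d x y == 0)%N = (x == y).
Hypothesis dS : forall x y z, e y z -> (d x z <= (d x y).+1)%N.
Hypothesis dP :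
  forall x y k, d x y = k.+1 -> exists2 z, d x z = k & e z y.

Lemma walk_dist x y : walk e (d x y) x y.
Proof.
move: {2}(d x y) (erefl (d x y)) => k; elim: k y => [|k IHk] y dxy.
  by rewrite dxy walk0 -d0 dxy.
have [z dxz ezy] := dP dxy.
by rewrite dxy walkS; apply/existsP; exists z; rewrite ezy -dxz IHk.
Qed.

Lemma dist_walk k x y : walk e k x y -> (d x y <= k)%N.
Proof.
elim: k y => [|k IHk] y; first by rewrite walk0 leqn0 d0.
rewrite walkS => /existsP[z /andP[/IHk dxz ezy]].
exact: leq_trans (dS x ezy) _.
Qed.

(** Descending along [dP] produces a walk of length [d x y], and by [dS] no shorter walk ends at
    [y], so [find] stops there; [d_lt] keeps this length inside the searched range [iota 0 #|T|]. *)
Lemma gdistE x y : gdist e x y = d x y.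
Proof.
rewrite /gdist; set P := fun k => _; set s := iota _ _.
have nthE k : (k < #|T|)%N -> nth 0 s k = k by move=> ?; rewrite nth_iota.
have hasP' : has P s.
  by apply/hasP; exists (d x y); rewrite ?mem_iota ?d_lt //; apply: walk_dist.
have lt_find : (find P s < #|T|)%N by rewrite has_find size_iota in hasP'.
apply/eqP; rewrite eqn_leq; apply/andP; split; last first.
  by apply: dist_walk; rewrite -{1}[find P s]nthE //; apply: (nth_find 0 hasP').
rewrite leqNgt; apply/negP => /(before_find 0).
by rewrite nthE ?d_lt // /P walk_dist.
Qed.

Lemma connected_dist : connected e.
Proof. by move=> x y; apply: walk_connect (walk_dist x y). Qed.

Lemma diameterE D x0 y0 :
  (forall x y, d x y <= D)%N -> d x0 y0 = D -> diameter e = D.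
Proof.
move=> leD eD; apply/eqP; rewrite eqn_leq; apply/andP; split.
  by apply/bigmax_leqP => -[x y] _ /=; rewrite gdistE.
rewrite -eD -gdistE.
exact: (@leq_bigmax _ (fun p : T * T => gdist e p.1 p.2) (x0, y0)).
Qed.

End Distance.

(** * Transport of graph properties along an isomorphism *)

Section Isomorphism.
Variables (T U : finType) (e : rel T) (e' : rel U) (f : T -> U).
Hypothesis f_bij : bijective f.
Hypothesis fE : forall x y, e' (f x) (f y) = e x y.

Lemma walk_iso k x y : walk e' k (f x) (f y) = walk e k x y.
Proof.
have [g fK gK] := f_bij.
elim: k y => [|k IHk] y; first by rewrite !walk0 (can_eq fK).
rewrite !walkS; apply/existsP/existsP => -[z].
  by rewrite -[z]gK IHk fE; exists (g z).
by exists (f z); rewrite IHk fE.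
Qed.

Lemma gdist_iso x y : gdist e' (f x) (f y) = gdist e x y.
Proof.
rewrite /gdist -(bij_eq_card f_bij).
by apply: eq_find => k; apply: walk_iso.
Qed.

Lemma diameter_iso : diameter e' = diameter e.
Proof.
have [g fK gK] := f_bij; rewrite /diameter.
rewrite (reindex (fun p : T * T => (f p.1, f p.2))) /=.
  by apply: eq_bigr => p _; rewrite gdist_iso.
exists (fun p : U * U => (g p.1, g p.2)) => -[x y] _ /=; first by rewrite !fK.
by rewrite !gK.
Qed.

Lemma connected_iso (r : rel T) (r' : rel U) :
  (forall x y, r' (f x) (f y) = r x y) -> connected r -> connected r'.
Proof.
move=> rE cr x y; have [g fK gK] := f_bij.
have [p rp lp] := connectP (cr (g x) (g y)).
apply/connectP; exists (map f p); last by rewrite -[x]gK last_map -lp gK.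
rewrite -[x]gK path_map; apply: sub_path rp => a b.
by rewrite /relpre /= rE.
Qed.

Lemma card_iso (P : pred T) (Q : pred U) :
  (forall x, Q (f x) = P x) -> #|[set x | Q x]| = #|[set x | P x]|.
Proof.
move=> QP; have [g fK gK] := f_bij.
rewrite -(card_imset [set x | P x] (can_inj fK)); apply: eq_card => y.
rewrite inE -[y]gK QP (mem_imset _ _ (can_inj fK)).
by rewrite inE.
Qed.

Lemma distance_regular_with_iso b c :
  distance_regular_with e b c -> distance_regular_with e' b c.
Proof.
have [g fK gK] := f_bij.
case=> -[sym irr] con db dc [[k reg] bc].
split; rewrite ?diameter_iso //.
- split=> [x y|x]; first by rewrite -[x]gK -[y]gK !fE sym.
  by rewrite -[x]gK fE irr.
- exact: connected_iso con.
split=> [|x y].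
  by exists k => x; rewrite -(reg (g x)); apply: card_iso => y; rewrite -fE gK.
rewrite -[x]gK -[y]gK !gdist_iso; have [<- <-] := bc (g x) (g y).
by split; apply: card_iso => z; rewrite fE gdist_iso.
Qed.

Lemma antipodal_iso : antipodal e -> antipodal e'.
Proof.
have [g fK gK] := f_bij.
move=> ant x y z; rewrite -[x]gK -[y]gK -[z]gK diameter_iso !gdist_iso.
by rewrite !(can_eq fK); apply: ant.
Qed.

Lemma distance_transitive_iso : distance_transitive e -> distance_transitive e'.
Proof.
have [g fK gK] := f_bij.
move=> dt x y x' y'; rewrite -[x]gK -[y]gK -[x']gK -[y']gK !gdist_iso.
move=> /dt[p [autp px py]].
have inj : injective (f \o p \o g).
  by apply: inj_comp (can_inj gK); apply: inj_comp (can_inj fK) perm_inj.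
exists (perm inj); split; rewrite ?permE /= ?fK ?px ?py // => a b.
by rewrite !permE /= fE autp -fE !gK.
Qed.

End Isomorphism.

(** Imprimitivity is a negation, so primitivity is pulled back from [e'] to [e] along the inverse
    bijection. *)
Lemma imprimitive_iso (T U : finType) (e : rel T) (e' : rel U) (f : T -> U) :
  bijective f -> (forall x y, e' (f x) (f y) = e x y) ->
  imprimitive e -> imprimitive e'.
Proof.
move=> f_bij fE imp [con prim]; apply: imp; have [g fK gK] := f_bij.
have g_bij : bijective g by exists f.
split=> [|i].
  by apply: (connected_iso g_bij _ con) => x y; rewrite -fE !gK.
rewrite -(diameter_iso f_bij fE) => /prim.
apply: (connected_iso g_bij) => x y.
by rewrite /distance_graph -(gdist_iso f_bij fE) !gK.
Qed.

(** * Distance transitivity from a base point *)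

Section Automorphisms.
Variables (T : finType) (e : rel T).
Implicit Types g h : {perm T}.

Lemma automorphismM g h :
  automorphism e g -> automorphism e h -> automorphism e (g * h)%g.
Proof. by move=> ag ah x y; rewrite !permM ah ag. Qed.

Lemma automorphismV g : automorphism e g -> automorphism e g^-1%g.
Proof. by move=> ag x y; rewrite -ag !permKV. Qed.

Lemma gdist_automorphism g x y :
  automorphism e g -> gdist e (g x) (g y) = gdist e x y.
Proof.
move=> ag; apply: gdist_iso ag x y.
by exists (g^-1)%g; [apply: permK | apply: permKV].
Qed.

(** Vertex transitivity brings both pairs to the base point [o], and the stabiliser of [o] is
    transitive on each sphere around it; permutation products act from left to right. *)
Lemma distance_transitive_based (o : T) :
  (forall x, exists2 g, automorphism e g & g x = o) ->
  (forall y y', gdist e o y = gdist e o y' ->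
     exists g, [/\ automorphism e g, g o = o & g y = y']) ->
  distance_transitive e.
Proof.
move=> tr st x y x' y' dxy.
have [g ag gx] := tr x; have [h ah hx] := tr x'.
have [|k [ak ko ky]] := st (g y) (h y').
  by rewrite -{1}gx -{1}hx !gdist_automorphism.
exists (g * k * h^-1)%g; split.
- by apply: automorphismM (automorphismV ah); apply: automorphismM.
- by rewrite !permM gx ko -hx permK.
- by rewrite !permM ky permK.
Qed.

End Automorphisms.

(** * The symplectic double cover and the Hadamard graph *)

Local Open Scope ring_scope.

Lemma addFF2 (a : 'F_2) : a + a = 0.
Proof. by apply: val_inj; case: a => -[|[|]]. Qed.

Lemma addvv_F2 p q (x : 'M['F_2]_(p, q)) : x + x = 0.
Proof. by apply/matrixP => i j; rewrite !mxE addFF2. Qed.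

Lemma addKv_F2 p q (y : 'M['F_2]_(p, q)) : involutive (+%R y).
Proof. by move=> x; rewrite addrA addvv_F2 add0r. Qed.

Lemma addv_eq0_F2 p q (x y : 'M['F_2]_(p, q)) : (x + y == 0) = (x == y).
Proof. by rewrite -(inj_eq (can_inj (addKv_F2 x))) addKv_F2 addr0 eq_sym. Qed.

(** * Nondegenerate alternating forms and transvections over the binary field *)

Section SymplecticCover.
Variable m : nat.
Local Notation V := 'cV['F_2]_m.
Variable B : V -> V -> bool.
Hypothesis BDl : forall x y z, B (x + y) z = B x z (+) B y z.
Hypothesis BC : forall x y, B x y = B y x.
Hypothesis Bxx : forall x, B x x = false.
Hypothesis Bnd : forall x, x != 0 -> exists y, B x y.
Implicit Types u v w x y z : V.

Lemma BDr x y z : B x (y + z) = B x y (+) B x z.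
Proof. by rewrite BC BDl !(BC x). Qed.

Lemma B0l x : B 0 x = false.
Proof. by have := BDl 0 0 x; rewrite addr0; case: B. Qed.

Lemma B0r x : B x 0 = false.
Proof. by rewrite BC B0l. Qed.

(** Two proper subspaces, here the orthogonals of [v] and [w], never cover the whole space: if a
    vector outside each lies in the other, their sum avoids both. *)
Lemma B_hyperbolic_common v w :
  v != 0 -> w != 0 -> exists z, B v z && B w z.
Proof.
move=> /Bnd[y1 v1] /Bnd[y2 w2].
have [w1|w1] := boolP (B w y1); first by exists y1; rewrite v1.
have [v2|v2] := boolP (B v y2); first by exists y2; rewrite w2 v2.
by exists (y1 + y2); rewrite !BDr v1 w2 (negPf v2) (negPf w1).
Qed.

Definition transvection v x : V := if B x v then x + v else x.

Lemma transvectionK v : involutive (transvection v).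
Proof.
move=> x; rewrite /transvection; case xv: (B x v); last by rewrite xv.
by rewrite BDl Bxx xv -addrA addvv_F2 addr0.
Qed.

Lemma transvection_B v x y :
  B (transvection v x) (transvection v y) = B x y.
Proof.
rewrite /transvection; case: ifP => xv; case: ifP => yv //;
by rewrite ?BDl ?BDr ?Bxx ?xv ?(BC v) ?yv ?xv ?addbF //; case: B.
Qed.

(** When [B x y] holds, the transvection along [x + y] sends [x] to [y]. Two such moves lead from
    [v] to [w] through a [z] orthogonal to neither. *)
Lemma Sp_transitive v w : v != 0 -> w != 0 ->
  exists g : {perm V},
    [/\ forall x y, B (g x) (g y) = B x y, g 0 = 0 & g v = w].
Proof.
have inj u : injective (transvection u) := can_inj (transvectionK u).
have move1 x y : B x y -> transvection (x + y) x = y.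
  by move=> xy; rewrite /transvection BDr Bxx xy /= addKv_F2.
have move0 u : transvection u 0 = 0 by rewrite /transvection B0l.
move=> v0 w0; have [z /andP[vz wz]] := B_hyperbolic_common v0 w0.
exists (perm (inj (v + z)) * perm (inj (z + w)))%g.
split=> [x y||]; rewrite !permM !permE ?move0 ?transvection_B //.
by rewrite !move1 // BC.
Qed.

Lemma card_V : #|{: V}| = (2 ^ m)%N.
Proof. by rewrite card_mx card_Fp // muln1. Qed.

(** Translation by a [z] with [B u z] exchanges the two level sets of [B u], so each is half of the
    space. *)
Lemma card_B u c : u != 0 -> #|[set w | B u w == c]| = (2 ^ m)./2.
Proof.
move=> /Bnd[z uz].
have e2 : #|[set w | B u w == true]| = #|[set w | B u w == false]|.
  apply: (card_iso (f := +%R z)); first by exists (+%R z); apply: addKv_F2.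
  by move=> w; rewrite BDr uz; case: B.
have : (#|[set w | B u w == true]| + #|[set w | B u w == false]|)%N = (2 ^ m)%N.
  rewrite -card_V -(cardsC [set w | B u w == true]); congr (_ + _)%N.
  by apply: eq_card => w; rewrite !inE; case: B.
rewrite e2 addnn => /(congr1 half); rewrite doubleK => <-.
by case: c; rewrite ?e2.
Qed.

(** * The symplectic double cover of the complete graph *)

Section Cover.
Variable eps : bool.
Hypothesis m_ge4 : (4 <= m)%N.

Definition cover_edge (x y : V * bool) : bool :=
  (x.1 != y.1) && (x.2 (+) y.2 == B x.1 y.1 (+) eps).

Definition cover_dist (x y : V * bool) : nat :=
  (if x.1 == y.1 then if x.2 == y.2 then 0 else 3
   else if x.2 (+) y.2 == B x.1 y.1 (+) eps then 1 else 2)%N.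

Definition cover_kappa : nat := ((2 ^ m)./2 - (if eps then 2 else 0))%N.

Lemma expn2_ge16 : (16 <= 2 ^ m)%N.
Proof. exact: (@leq_pexp2l 2 4 m). Qed.

(** This count is both [b_1] and [c_2]. The vectors [0] and [u] are orthogonal to [u]: excluding
    them costs 2 when the orthogonal of [u] is counted ([eps] true) and nothing when its complement
    is. *)
Lemma cover_kappaE u : u != 0 ->
  #|[set w | (w != 0) && (w != u) && (B u w == ~~ eps)]| = cover_kappa.
Proof.
move=> u0; rewrite /cover_kappa; case: eps => /=; last first.
  rewrite subn0 -(card_B true u0); apply: eq_card => w; rewrite !inE.
  case: eqP => [->|_] /=; first by rewrite B0r.
  by case: eqP => [->|_] //=; rewrite Bxx.
rewrite -(card_B false u0); set A := [set w | B u w == false].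
rewrite (cardsD1 0 A) (cardsD1 u (A :\ 0)) !inE B0r Bxx u0 /=.
rewrite add1n add1n subn2 /=; apply: eq_card => w; rewrite !inE.
by case: (w == 0); case: (w == u).
Qed.

Lemma cover_kappa_gt0 : (0 < cover_kappa)%N.
Proof.
rewrite /cover_kappa; have := half_leq expn2_ge16; case: eps => /= h.
  by rewrite subn_gt0; apply: leq_trans h.
by rewrite subn0; apply: leq_trans h.
Qed.

(** The adjacency equation determines the bit of a neighbour from its vector, so all neighbour
    counts become counts in [V]. *)
Lemma card_cover_nbr (y : V * bool) (P : pred (V * bool)) :
  #|[set w | cover_edge y w & P w]|
    = #|[set z | z != y.1 & P (z, y.2 (+) B y.1 z (+) eps)]|.
Proof.
rewrite -(card_imset _ (f := fun z => (z, y.2 (+) B y.1 z (+) eps))); last first.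
  by move=> z z' [].
apply: eq_card => -[z c]; rewrite !inE /cover_edge /=.
apply/andP/imsetP => [[/andP[yz /eqP yc] Pz]|[z']].
  exists z; last by congr pair; rewrite -addbA -yc addKb.
  by rewrite inE eq_sym yz -addbA -yc addKb.
rewrite inE => /andP[z'y Pz'] [-> ->]; split=> //.
by rewrite eq_sym z'y -addbA addKb /=.
Qed.

Lemma cover_dist_sym (x y : V * bool) : cover_dist x y = cover_dist y x.
Proof. by rewrite /cover_dist eq_sym [y.2 == _]eq_sym addbC BC. Qed.

Lemma cover_edgeE (x y : V * bool) : cover_edge x y = (cover_dist x y == 1%N).
Proof.
rewrite /cover_edge /cover_dist; case: (x.1 == y.1) => /=; first by case: ifP.
by case: ifP.
Qed.

Lemma cover_dist_le3 (x y : V * bool) : (cover_dist x y <= 3)%N.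
Proof. by rewrite /cover_dist; do !case: ifP => _. Qed.

Let d_lt (x y : V * bool) : (cover_dist x y < #|{: V * bool}|)%N.
Proof.
rewrite card_prod card_V card_bool; apply: leq_ltn_trans (cover_dist_le3 x y) _.
apply: leq_trans (leq_mul expn2_ge16 (leqnn 2)).
by [].
Qed.

Let d0 (x y : V * bool) : (cover_dist x y == 0)%N = (x == y).
Proof.
case: x y => [x a] [y b]; rewrite /cover_dist xpair_eqE /=.
by case: (x == y) => //=; case: ifP.
Qed.

Let dS (x y z : V * bool) : cover_edge y z -> (cover_dist x z <= (cover_dist x y).+1)%N.
Proof.
case: x y z => [x a] [y b] [z c]; rewrite /cover_edge /cover_dist /=.
case/andP=> yz /eqP bc; have [->|xy] := eqVneq x y.
  rewrite (negPf yz); have [->|_] := eqVneq a b; last by case: ifP.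
  by rewrite bc eqxx.
have [->|xz] := eqVneq x z; last by do 2!case: ifP.
case: eqP => // /eqP ac; rewrite (BC z); case: eqP => // ab.
by move: ab bc ac; case: (B _ _) eps a b c => -[] [] [] [].
Qed.

Let dP (x y : V * bool) k : cover_dist x y = k.+1 ->
  exists2 z, cover_dist x z = k & cover_edge z y.
Proof.
case: x y => [x a] [y b]; rewrite {1}/cover_dist /=.
have [<-|xy] := eqVneq x y.
  have [//|ab [<-]] := eqVneq a b.
  (* Distance 3: the two vertices lie over the same [x] with opposite bits, and any neighbour of the
     second is at distance 2 from the first. *)
  have [w xw] : exists w, x != w.
    suff /card_gt0P[w] : (0 < #|~: [set x]|)%N by rewrite !inE eq_sym; exists w.
    by rewrite cardsC1 card_V; have := expn2_ge16; case: (2 ^ m)%N => [|[]].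
  exists (w, b (+) B w x (+) eps); rewrite /cover_dist /cover_edge /=.
    rewrite (negPf xw) (BC w); case: ifP => // /eqP h; move: ab h.
    by case: (B _ _) eps a b => -[] [] [].
  by rewrite eq_sym xw /= -[b (+) _ (+) _]addbA addbC addKb.
case: eqP => [ab [<-]|/eqP ab [<-]].
  exists (x, a); rewrite /cover_edge ?xy /= ?ab ?eqxx //.
  by rewrite /cover_dist /= !eqxx.
have xy0 : x + y != 0 by rewrite addv_eq0_F2.
(* Distance 2: the neighbour of [(x, a)] over [x + w] is also adjacent to [(y, b)] exactly when [w]
   avoids [0] and [x + y] and [B (x + y) w] equals [~~ eps]. *)
have : (0 < #|[set w | (w != 0) && (w != x + y) && (B (x + y) w == ~~ eps)]%R|)%N.
  by rewrite cover_kappaE // cover_kappa_gt0.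
case/card_gt0P => w; rewrite !inE => /andP[/andP[w0 wu] /eqP Bw].
have xw : x != x + w.
  by rewrite -[X in X == _]addr0 (inj_eq (addrI x)) eq_sym.
have yw : x + w != y.
  by rewrite -[y](addKv_F2 x) (inj_eq (addrI x)).
exists (x + w, a (+) B x (x + w) (+) eps); rewrite /cover_dist /cover_edge /=.
  by rewrite (negPf xw) -addbA addKb eqxx.
rewrite yw /=; move: ab Bw; rewrite !BDr !BDl Bxx (BC w).
by case: (B x w) (B x y) (B y w) eps a b => -[] [] [] [] [].
Qed.

Lemma cover_gdist (x y : V * bool) : gdist cover_edge x y = cover_dist x y.
Proof. exact: gdistE. Qed.

Lemma cover_connected : connected cover_edge.
Proof. exact: connected_dist d0 dP. Qed.

Lemma cover_diameter : diameter cover_edge = 3%N.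
Proof.
apply: (diameterE d_lt d0 dS dP (x0 := (0, true)) (y0 := (0, false))).
  exact: cover_dist_le3.
by rewrite /cover_dist /= eqxx.
Qed.

(** Translating by [x] leaves counts over [w] depending on [u = x + y]. The case [u = 0] covers
    distances 0 and 3; otherwise [w = 0] is the single exceptional neighbour, giving [c_1] and
    [b_2], and [cover_kappaE] gives [b_1] and [c_2]. *)
Lemma cover_distance_regular :
  distance_regular_with cover_edge
    [:: (2 ^ m - 1)%N; cover_kappa; 1%N] [:: 1%N; cover_kappa; (2 ^ m - 1)%N].
Proof.
have cardN1 x : #|[set z : V | z != x]| = (2 ^ m - 1)%N.
  rewrite -card_V subn1 -(cardsC1 x); apply: eq_card => z.
  by rewrite !inE.
split; rewrite ?cover_diameter //.
- split=> [x y|x]; first by rewrite !cover_edgeE cover_dist_sym.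
  by rewrite cover_edgeE /cover_dist !eqxx.
- exact: cover_connected.
split.
  exists (2 ^ m - 1)%N => x; rewrite -(cardN1 x.1).
  have := card_cover_nbr x predT.
  rewrite (eq_card (B := [set w | cover_edge x w])) => [->|w].
    by apply: eq_card => w; rewrite !inE andbT.
  by rewrite !inE andbT.
move=> [x a] [y b]; rewrite !card_cover_nbr.
have transl (P : pred V) : #|[set z | P z]| = #|[set w | P (x + w)]|.
  apply: (card_iso (f := +%R x)) => //.
  by exists (+%R x); apply: addKv_F2.
rewrite !(transl (fun z => (z != _) && _)) /=.
have xx w : (x == x + w) = (w == 0).
  by rewrite -{1}[x]addr0 (inj_eq (addrI x)) eq_sym.
rewrite -[y](addKv_F2 x); set u := x + y.
rewrite !cover_gdist /cover_dist /= xx.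
under eq_finset => w do rewrite (inj_eq (addrI x)) cover_gdist /cover_dist /= xx.
under [in X in _ /\ X]eq_finset => w
  do rewrite (inj_eq (addrI x)) cover_gdist /cover_dist /= xx.
move: u => u {y}; have [->|u0] := eqVneq u 0.
  rewrite addr0; have [->|ab] := eqVneq a b => /=.
    split; first by apply: eq_card0 => w; rewrite !inE andbF.
    rewrite -(cardN1 0); apply: eq_card => w; rewrite !inE.
    by case: eqP => //= _; case: (B _ _) eps b => -[] [].
  split.
    rewrite -(cardN1 0); apply: eq_card => w; rewrite !inE.
    case: eqP => //= _; move: ab.
    by case: (B _ _) eps a b => -[] [] [].
  apply: eq_card0 => w; rewrite !inE; case: eqP => //= _.
  by case: ifP.
have u0' : 0 != u by rewrite eq_sym.
rewrite !BDr Bxx /=; case: (eqVneq (a (+) b) _) => ab /=.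
  split.
    apply: etrans (cards1 (0 : V)); apply: eq_card => w; rewrite !inE.
    case: (eqVneq w 0) => [->|w0]; last by case: (_ == _); case: ifP.
    rewrite u0' !BDr !B0r BDl Bxx (BC u).
    by move: ab; case: (B _ _) eps a b => -[] [] [].
  rewrite -(cover_kappaE u0); apply: eq_card => w; rewrite !inE.
  case: (eqVneq w 0) => [->|w0] /=; first by rewrite u0'; case: ifP.
  congr (_ && _); rewrite !BDr !BDl Bxx (BC u x).
  by move: ab; case: (B x w) (B u w) (B x u) eps a b => -[] [] [] [] [].
split.
  rewrite -(cover_kappaE u0); apply: eq_card => w; rewrite !inE.
  case: (eqVneq w 0) => [->|w0] /=; first by rewrite u0'; case: ifP.
  congr (_ && _); rewrite !BDr !BDl Bxx (BC u x).
  by move: ab; case: (B x w) (B u w) (B x u) eps a b => -[] [] [] [] [].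
(* For [b_2]: the neighbour of the second vertex over [x] itself, that is [w = 0], is the antipode
   of the first. *)
apply: etrans (cards1 (0 : V)); apply: eq_card => w; rewrite !inE.
case: (eqVneq w 0) => [->|w0]; last by case: (_ == u); case: ifP.
rewrite u0' !BDr !B0r BDl Bxx (BC u).
by move: ab; case: (B _ _) eps a b => -[] [] [].
Qed.

(** The antipodal classes are the fibres of the projection to [V]. *)
Lemma cover_antipodal : antipodal cover_edge.
Proof.
have E (x y : V * bool) :
  ((x == y) || (gdist cover_edge x y == diameter cover_edge)) = (x.1 == y.1).
  rewrite cover_gdist cover_diameter -d0 /cover_dist.
  by case: (x.1 == y.1); case: ifP.
by move=> x y z; rewrite !E; split=> // /eqP ->.
Qed.

(** A path in the distance-3 graph never leaves a fibre of the projection to [V]. *)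
Lemma cover_imprimitive : imprimitive cover_edge.
Proof.
case=> _ /(_ 3%N); rewrite cover_diameter => /(_ isT) con.
have m_gt0 : (0 < m)%N by apply: leq_trans m_ge4.
pose w : V := const_mx 1.
have w0 : w != 0.
  by apply/eqP => /matrixP/(_ (Ordinal m_gt0) 0); rewrite !mxE.
have [p pp lp] := connectP (con (0, true) (w, true)).
suff /eqP : (last (0 : V, true) p).1 = 0 by rewrite -lp (negPf w0).
have: (0 : V, true).1 = 0 by [].
elim: p {lp} (0, true) pp => //= z p IHp y /andP[yz pp] y0.
apply: IHp pp _; move: yz; rewrite /distance_graph cover_gdist /cover_dist.
by rewrite y0; case: (eqVneq 0 z.1) => // _; case: ifP.
Qed.

Lemma cover_distance_transitive : distance_transitive cover_edge.
Proof.
apply: (@distance_transitive_based _ _ (0, false)).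
  move=> [x a].
  (* Translation by [x] lifted to the cover; the correction [B x z.1] of the bit absorbs the change
     of [B] under translation. *)
  pose f (z : V * bool) : V * bool := (x + z.1, z.2 (+) B x z.1 (+) a).
  have fK : involutive f.
    move=> [z c]; rewrite /f /= addKv_F2 BDr Bxx.
    by congr pair; case: (B _ _) (a) c => -[] [].
  exists (perm (can_inj fK)) => [[y b] [z c]|].
    rewrite !permE /cover_edge /f /= (inj_eq (addrI x)) !BDr !BDl Bxx (BC y x).
    by congr (_ && _); case: (B x y) (B x z) (B y z) (a) b c eps => -[] [] [] [] [] [].
  by rewrite permE /f /= addvv_F2 Bxx addbF addbb.
move=> [y b] [y' b']; rewrite !cover_gdist /cover_dist /= ![0 == _]eq_sym !B0l.
have [->|y0] := eqVneq y 0; have [->|y'0] := eqVneq y' 0.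
- move=> bb; exists 1%g; split=> [x x0||]; rewrite ?perm1 //.
  by congr pair; move: bb; case: (b) (b') => -[].
- by case: ifP => // _; case: ifP.
- by case: ifP => // _; case: ifP.
(* Since [B 0 y] vanishes, the distance from the base point to [(y, b)] with [y] nonzero depends on
   [b] alone, so a symplectic map that keeps the bit suffices. *)
move=> bb; have [g [gB g0 gy]] := Sp_transitive y0 y'0.
pose f (z : V * bool) : V * bool := (g z.1, z.2).
have f_inj : injective f by move=> [z c] [z' c'] [/perm_inj-> ->].
exists (perm f_inj); split=> [[z c] [z' c']||]; rewrite !permE /f /= ?g0 ?gy //.
  by rewrite /cover_edge /= gB (inj_eq perm_inj).
by congr pair; move: bb; case: eps (b) (b') => -[] [].
Qed.
End Cover.

(** * The Hadamard graph of the symplectic form *)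

Section Hadamard.
Hypothesis m_ge4 : (4 <= m)%N.
Local Notation W := (V * bool * bool)%type.

(** In a triple the vector indexes a row or a column of the Hadamard matrix, the first bit is a sign
    and the second bit is the side of the bipartition. *)
Definition hadamard_edge (x y : W) : bool :=
  (x.2 != y.2) && (x.1.2 (+) y.1.2 == B x.1.1 y.1.1).

Definition hadamard_dist (x y : W) : nat :=
  (if x.2 == y.2 then
     if x.1.1 == y.1.1 then if x.1.2 == y.1.2 then 0 else 4 else 2
   else if x.1.2 (+) y.1.2 == B x.1.1 y.1.1 then 1 else 3)%N.

Lemma card_hadamard_nbr (y : W) (P : pred W) :
  #|[set w | hadamard_edge y w & P w]|
    = #|[set z | P (z, y.1.2 (+) B y.1.1 z, ~~ y.2)]|.
Proof.
rewrite -(card_imset _ (f := fun z => (z, y.1.2 (+) B y.1.1 z, ~~ y.2))); last first.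
  by move=> z z' [].
apply: eq_card => -[[z c] q]; rewrite !inE /hadamard_edge /=.
apply/andP/imsetP => [[/andP[yz /eqP yc] Pz]|[z']].
  have qE : q = ~~ y.2 by move: yz; case: (y.2) q {Pz} => -[].
  by exists z; rewrite ?inE -yc addKb -qE.
rewrite inE => Pz' [-> -> ->]; split=> //.
by rewrite addKb eqxx andbT; case: y.2.
Qed.

Lemma hadamard_dist_sym (x y : W) : hadamard_dist x y = hadamard_dist y x.
Proof.
by rewrite /hadamard_dist eq_sym [y.1.1 == _]eq_sym [y.1.2 == _]eq_sym addbC BC.
Qed.

Lemma hadamard_edgeE (x y : W) : hadamard_edge x y = (hadamard_dist x y == 1%N).
Proof.
rewrite /hadamard_edge /hadamard_dist; case: (x.2 == y.2) => /=.
  by do !case: ifP.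
by case: ifP.
Qed.

Lemma hadamard_dist_le4 (x y : W) : (hadamard_dist x y <= 4)%N.
Proof. by rewrite /hadamard_dist; do !case: ifP => _. Qed.

Let d_lt (x y : W) : (hadamard_dist x y < #|{: W}|)%N.
Proof.
rewrite !card_prod card_V card_bool.
apply: leq_ltn_trans (hadamard_dist_le4 x y) _.
apply: leq_trans (leq_mul (leq_mul (expn2_ge16 m_ge4) (leqnn 2)) (leqnn 2)).
by [].
Qed.

Let d0 (x y : W) : (hadamard_dist x y == 0)%N = (x == y).
Proof.
case: x y => [[x a] p] [[y b] q]; rewrite /hadamard_dist !xpair_eqE /=.
case: (p == q); case: (x == y); case: (a == b) => //=; by case: ifP.
Qed.

Let dS (x y z : W) :
  hadamard_edge y z -> (hadamard_dist x z <= (hadamard_dist x y).+1)%N.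
Proof.
case: x y z => [[x a] p] [[y b] q] [[z c] r]; rewrite /hadamard_edge /hadamard_dist /=.
case/andP=> qr /eqP bc; have [->|pq] := eqVneq p q.
  rewrite (negPf qr); have [->|xy] := eqVneq x y; last by case: ifP.
  have [->|_] := eqVneq a b; last by case: ifP.
  by rewrite bc eqxx.
have -> : p == r by move: qr pq; case: p q r => -[] [].
have [->|xz] := eqVneq x z; last by case: ifP.
rewrite -(BC y) -bc; case: ifP => // ac; case: ifP => //.
by move: ac; case: (a) (b) (c) => -[] [].
Qed.

Let dP (x y : W) k : hadamard_dist x y = k.+1 ->
  exists2 z, hadamard_dist x z = k & hadamard_edge z y.
Proof.
case: x y => [[x a] p] [[y b] q]; rewrite {1}/hadamard_dist /=.
have [<-|pq] := eqVneq p q.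
  have pn : (p == ~~ p) = false by case: (p).
  have np : (~~ p == p) = false by case: (p).
  have [<-|xy] := eqVneq x y.
    have [//|ab [<-]] := eqVneq a b.
    exists (x, b, ~~ p); rewrite /hadamard_dist /hadamard_edge /= ?np ?pn Bxx.
      by move: ab; case: (a) (b) => -[].
    by rewrite addbb.
  move=> [<-].
  (* Distance 2: a common neighbour over [x + w] amounts to this linear equation in [w], solvable
     because [x + y] is nonzero and [B] nondegenerate. *)
  have [w Bw] : exists w, B (x + y) w = a (+) b (+) B x y.
    case: (a (+) b (+) B x y); last by exists 0; rewrite B0r.
    by apply: Bnd; rewrite addv_eq0_F2.
  exists (x + w, a (+) B x w, ~~ p); rewrite /hadamard_dist /hadamard_edge /= ?np ?pn.
    by rewrite BDr Bxx addKb eqxx.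
  move: Bw; rewrite !BDl (BC w).
  by case: (B x w) (B x y) (B y w) (a) (b) => -[] [] [] [].
case: eqP => [ab [<-]|/eqP ab [<-]].
  by exists (x, a, p); rewrite /hadamard_edge /hadamard_dist /= ?pq ?ab !eqxx.
(* Distance 3: any neighbour of [y] over a vector other than [x] lies on the side of [x], hence at
   distance 2 from it. *)
have [w xw] : exists w, w != 0.
  suff /card_gt0P[w] : (0 < #|~: [set 0%R : V]|)%N by rewrite !inE; exists w.
  by rewrite cardsC1 card_V; have := expn2_ge16 m_ge4; case: (2 ^ m)%N => [|[]].
have xw' : (x == x + w) = false.
  by rewrite -[X in X == _]addr0 (inj_eq (addrI x)) eq_sym (negPf xw).
exists (x + w, b (+) B (x + w) y, p); rewrite /hadamard_dist /hadamard_edge /=.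
  by rewrite eqxx xw'.
by rewrite pq addbC addKb eqxx.
Qed.

Lemma hadamard_gdist (x y : W) : gdist hadamard_edge x y = hadamard_dist x y.
Proof. exact: gdistE. Qed.

Lemma hadamard_connected : connected hadamard_edge.
Proof. exact: connected_dist d0 dP. Qed.

Lemma hadamard_diameter : diameter hadamard_edge = 4%N.
Proof.
apply: (diameterE d_lt d0 dS dP (x0 := (0, true, true)) (y0 := (0, false, true))).
  exact: hadamard_dist_le4.
by rewrite /hadamard_dist /= eqxx.
Qed.

Lemma hadamard_distance_regular :
  distance_regular_with hadamard_edge
    [:: (2 ^ m)%N; (2 ^ m - 1)%N; (2 ^ m)./2; 1%N]
    [:: 1%N; (2 ^ m)./2; (2 ^ m - 1)%N; (2 ^ m)%N].
Proof.
have cardN1 x : #|[set z : V | z != x]| = (2 ^ m - 1)%N.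
  rewrite -card_V subn1 -(cardsC1 x); apply: eq_card => z.
  by rewrite !inE.
have cardT : #|[set: V]| = (2 ^ m)%N by rewrite cardsT card_V.
split; rewrite ?hadamard_diameter //.
- split=> [x y|x]; first by rewrite !hadamard_edgeE hadamard_dist_sym.
  by rewrite hadamard_edgeE /hadamard_dist !eqxx.
- exact: hadamard_connected.
split.
  exists (2 ^ m)%N => x; rewrite -cardT.
  have := card_hadamard_nbr x predT.
  rewrite (eq_card (B := [set w | hadamard_edge x w])) => [->|w].
    by apply: eq_card => w; rewrite !inE.
  by rewrite !inE andbT.
move=> [[x a] p] [[y b] q]; rewrite !card_hadamard_nbr.
have transl (P : pred V) : #|[set z | P z]| = #|[set w | P (x + w)]|.
  apply: (card_iso (f := +%R x)) => //.
  by exists (+%R x); apply: addKv_F2.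
rewrite [X in X = _ /\ _]transl [X in _ /\ X = _]transl /=.
have xx w : (x == x + w) = (w == 0).
  by rewrite -{1}[x]addr0 (inj_eq (addrI x)) eq_sym.
rewrite -[y](addKv_F2 x); set u := x + y.
rewrite !hadamard_gdist /hadamard_dist /= xx.
under eq_finset => w do rewrite hadamard_gdist /hadamard_dist /= xx.
under [in X in _ /\ X]eq_finset => w
  do rewrite hadamard_gdist /hadamard_dist /= xx.
move: u => u {y}; have [<-|pq] := eqVneq p q.
  have -> : (p == ~~ p) = false by case: (p).
  have [->|u0] := eqVneq u 0.
    rewrite addr0; have [->|ab] := eqVneq a b => /=; split.
    - by apply: eq_card0 => w; rewrite !inE.
    - by rewrite -cardT; apply: eq_card => w; rewrite !inE addKb eqxx.
    - rewrite -cardT; apply: eq_card => w; rewrite !inE.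
      by move: ab; case: (B _ _) (a) (b) => -[] [].
    - by apply: eq_card0 => w; rewrite !inE; case: ifP.
  split=> /=.
    (* The neighbour of [y] over [x + w] is adjacent to [x] when [B u w] has this value and at
       distance 3 otherwise, so [c_2] and [b_2] are both half of [2 ^ m]. *)
    rewrite -(card_B (a (+) b (+) B x u) u0); apply: eq_card => w; rewrite !inE.
    rewrite !BDr !BDl Bxx (BC u x).
    by case: (B x w) (B u w) (B x u) (a) (b) => -[] [] [] [].
  rewrite -(card_B (~~ (a (+) b (+) B x u)) u0); apply: eq_card => w; rewrite !inE.
  rewrite !BDr !BDl Bxx (BC u x).
  by case: (B x w) (B u w) (B x u) (a) (b) => -[] [] [] [].
have -> : p == ~~ q by move: pq; case: (p) (q) => -[].
case: (eqVneq (a (+) b) _) => ab /=; split.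
- apply: etrans (cards1 (0 : V)); apply: eq_card => w; rewrite !inE.
  case: (eqVneq w 0) => [->|//]; move: ab.
  rewrite addr0 BDr BDl Bxx (BC u).
  by case: (B _ _) (a) (b) => -[] [].
- rewrite -(cardN1 0); apply: eq_card => w; rewrite !inE.
  by case: (eqVneq w 0) => //; case: ifP.
- rewrite -(cardN1 0); apply: eq_card => w; rewrite !inE.
  by case: (eqVneq w 0) => //; case: ifP.
apply: etrans (cards1 (0 : V)); apply: eq_card => w; rewrite !inE.
case: (eqVneq w 0) => [->|//]; move: ab.
rewrite addr0 BDr BDl Bxx (BC u).
by case: (B _ _) (a) (b) => -[] [].
Qed.

Lemma hadamard_antipodal : antipodal hadamard_edge.
Proof.
have E (x y : W) :
  ((x == y) || (gdist hadamard_edge x y == diameter hadamard_edge))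
    = (x.2 == y.2) && (x.1.1 == y.1.1).
  rewrite hadamard_gdist hadamard_diameter -d0 /hadamard_dist.
  by case: (x.2 == y.2); case: (x.1.1 == y.1.1) => //=; case: ifP.
move=> x y z; rewrite !E !eqxx; split=> // /andP[/eqP-> /eqP->].
by [].
Qed.

(** Vertices at distance 4 are on the same side, so the distance-4 graph does not join the two
    sides. *)
Lemma hadamard_imprimitive : imprimitive hadamard_edge.
Proof.
case=> _ /(_ 4%N); rewrite hadamard_diameter => /(_ isT) con.
have [p pp lp] := connectP (con (0, true, true) (0, true, false)).
suff : (last (0 : V, true, true) p).2 = true by rewrite -lp.
have: (0 : V, true, true).2 = true by [].
elim: p {lp} (0, true, true) pp => //= z p IHp y /andP[yz pp] y0.
apply: IHp pp _; move: yz; rewrite /distance_graph hadamard_gdist /hadamard_dist.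
by rewrite y0; case: z.2 => //=; case: ifP.
Qed.

(* Fixes [(0, false, p)] while translating the other side of the bipartition:
   this is what the symplectic group alone cannot do. *)
Definition half_shift (p : bool) (u : V) (x : W) : W :=
  if x.2 == p then (x.1.1, x.1.2 (+) B u x.1.1, x.2) else (u + x.1.1, x.1.2, x.2).

Lemma half_shiftK p u : involutive (half_shift p u).
Proof.
move=> [[x a] q]; rewrite /half_shift /=; case qp: (q == p); rewrite /= qp.
  by rewrite -addbA addbb addbF.
by rewrite addKv_F2.
Qed.

(** For vertices on opposite sides, one vector is translated by [u] and the other vertex has the
    matching value of [B u] added to its bit; both sides of the adjacency equation change
    equally. *)
Lemma half_shift_automorphism p u :
  automorphism hadamard_edge (perm (can_inj (half_shiftK p u))).
Proof.
move=> [[x a] q] [[y b] r]; rewrite !permE /half_shift /hadamard_edge /=.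
case: (eqVneq q p) => qp; case: (eqVneq r p) => rp /=; rewrite ?qp ?rp ?eqxx //=.
- by congr (_ && _); rewrite BDr (BC u); case: (B x u) (B x y) (a) b => -[] [] [].
- by congr (_ && _); rewrite BDl; case: (B u y) (B x y) (a) b => -[] [] [].
suff -> : q == r by [].
by move: qp rp; case: (p) (q) (r) => -[] [].
Qed.

Lemma hadamard_distance_transitive : distance_transitive hadamard_edge.
Proof.
apply: (@distance_transitive_based _ _ (0, false, false)).
  move=> [[x a] p].
  (* This map clears the bit [a] and the side [p]; the half shift by [x] of the side [false] then
     brings the vector to [0]. *)
  pose f (z : W) : W := (z.1.1, z.1.2 (+) a, z.2 (+) p).
  have fK : involutive f.
    by move=> [[z c] r]; rewrite /f /= -!addbA !addbb !addbF.
  exists (perm (can_inj fK) * perm (can_inj (half_shiftK true x)))%g.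
    apply: automorphismM (half_shift_automorphism _ _) => -[[y b] q] [[z c] r].
    rewrite !permE /hadamard_edge /f /=.
    by congr (_ && _); [case: (p) q r => -[] [] | case: (a) b c (B y z) => -[] [] []].
  by rewrite permM !permE /f /half_shift /= !addbb /= addvv_F2.
move=> [[y b] q] [[y' b'] q'].
rewrite !hadamard_gdist /hadamard_dist /= ![0 == _]eq_sym !B0l.
case: q; case: q' => /=; try by do !case: ifP.
(* On the side opposite to the base point the distance fixes the bit, and this half shift translates
   [y] to [y']. *)
- move=> bb; exists (perm (can_inj (half_shiftK false (y + y')))).
  split; first exact: half_shift_automorphism.
    by rewrite permE /half_shift /= B0r.
  rewrite permE /half_shift /= addrC addKv_F2.
  by move: bb; case: (b) (b') => -[].
have [->|y0] := eqVneq y 0; have [->|y'0] := eqVneq y' 0.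
- move=> bb; exists 1%g; split=> [x x0||]; rewrite ?perm1 //.
  by move: bb; case: (b) (b') => -[].
- by case: ifP.
- by case: ifP.
move=> _; have [g [gB g0 gy]] := Sp_transitive y0 y'0.
pose f (z : W) : W := (g z.1.1, z.1.2, z.2).
have f_inj : injective f by move=> [[z c] r] [[z' c'] r'] [/perm_inj-> -> ->].
(* At distance 2 both bits occur; after the symplectic move, a half shift changing bits on this side
   corrects [b] to [b']. *)
have [u Bu] : exists u, B u y' = b (+) b'.
  case: (b (+) b'); last by exists 0; rewrite B0l.
  by have [u] := Bnd y'0; rewrite BC; exists u.
exists (perm f_inj * perm (can_inj (half_shiftK false u)))%g; split.
- apply: automorphismM (half_shift_automorphism _ _) => -[[z c] r] [[z' c'] r'].
  by rewrite !permE /hadamard_edge /= gB.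
- by rewrite permM !permE /f /half_shift /= g0 B0r.
- by rewrite permM !permE /f /half_shift /= gy Bu addKb.
Qed.
End Hadamard.
End SymplecticCover.

(** * Q-polynomial structure of the double cover *)

Section IdempotentBasis.
Variables (T : finType) (e : rel T) (R : fieldType) (k : nat).
Variable E : 'I_k -> 'M[R]_#|T|.
Hypothesis EM : forall i j, E i *m E j = if i == j then E i else 0.
Hypothesis E_neq0 : forall i, E i != 0.
Hypothesis E_span :
  forall M, in_bose_mesner e M <-> exists a : 'I_k -> R, M = \sum_i a i *: E i.

Lemma idempotent_basis_inj : injective E.
Proof.
move=> i j Eij; apply/eqP; have := EM i j.
by case: eqP => // _ /eqP; rewrite -Eij EM eqxx (negPf (E_neq0 i)).
Qed.

Lemma sum_idempotent_mulr (a : 'I_k -> R) j :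
  (\sum_i a i *: E i) *m E j = a j *: E j.
Proof.
rewrite mulmx_suml (bigD1 j) //= -scalemxAl EM eqxx big1 ?addr0 // => i ij.
by rewrite -scalemxAl EM (negPf ij) scaler0.
Qed.

Lemma scale_idempotent_eq (c c' : R) j : c *: E j = c' *: E j -> c = c'.
Proof.
move/eqP; rewrite -subr_eq0 -scalerBl scaler_eq0 (negPf (E_neq0 j)) orbF.
by rewrite subr_eq0 => /eqP.
Qed.

(** An idempotent has coordinates 0 or 1 in a basis of orthogonal idempotents. A nonzero coordinate
    of [M] at [j] puts [E j] below [M], and minimality of [M] forces equality. *)
Lemma primitive_idempotent_basis M :
  primitive_idempotent e M <-> exists j, M = E j.
Proof.
have E_in j : in_bose_mesner e (E j).
  apply/E_span; exists (fun i => (i == j)%:R).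
  rewrite (bigD1 j) //= eqxx scale1r big1 ?addr0 // => i /negPf ->.
  by rewrite scale0r.
split=> [[/E_span[a defM] M0 MM Mmin]|[j ->]].
  have [j aj] : exists j, a j != 0.
    apply/existsP; apply: contraR M0 => /existsPn a0.
    by rewrite defM big1 // => i _; move/negPn: (a0 i) => /eqP ->; rewrite scale0r.
  have MEj : M *m E j = a j *: E j by rewrite defM sum_idempotent_mulr.
  have aj1 : a j = 1.
    have : a j * a j = a j.
      apply: (@scale_idempotent_eq _ _ j).
      by rewrite -scalerA -MEj scalemxAr -MEj mulmxA MM.
    by move=> ajj; apply: (mulfI aj); rewrite mulr1.
  have EjM : E j *m M = E j.
    rewrite defM mulmx_sumr (bigD1 j) //= -scalemxAr EM eqxx aj1 scale1r.
    rewrite big1 ?addr0 // => i ij.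
    by rewrite -scalemxAr EM eq_sym (negPf ij) scaler0.
  exists j; case: (Mmin (E j)) => //; first by rewrite EM eqxx.
  by move=> Ej0; have := E_neq0 j; rewrite Ej0 eqxx.
split; rewrite ?EM ?eqxx // => F /E_span[a defF] FF FEj.
have {defF} defF : F = a j *: E j by rewrite -sum_idempotent_mulr -defF.
have : a j * a j = a j.
  apply: (@scale_idempotent_eq _ _ j).
  by move: FF; rewrite defF -scalemxAl -scalemxAr EM eqxx scalerA.
have [a0 _|aj ajj] := eqVneq (a j) 0; first by left; rewrite defF a0 scale0r.
by right; rewrite defF (_ : a j = 1) ?scale1r //; apply: (mulfI aj); rewrite mulr1.
Qed.

End IdempotentBasis.

(** * The Bose-Mesner algebra of the double cover *)

Section CoverQPolynomial.
Variables (R : realFieldType) (m : nat).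
Local Notation V := 'cV['F_2]_m.
Variable B : V -> V -> bool.
Hypothesis BDl : forall x y z, B (x + y) z = B x z (+) B y z.
Hypothesis BC : forall x y, B x y = B y x.
Hypothesis Bxx : forall x, B x x = false.
Hypothesis Bnd : forall x, x != 0 -> exists y, B x y.
Variable eps : bool.
Hypothesis m_ge4 : (4 <= m)%N.
Variables (T : finType) (e : rel T) (f : V * bool -> T) (g : T -> V * bool).
Hypotheses (fK : cancel f g) (gK : cancel g f).
Hypothesis fE : forall x y, e (f x) (f y) = cover_edge B eps x y.
Variable s : R.
Hypotheses (s_gt1 : 1 < s) (s2 : (2 ^ m)%:R = s ^+ 2).
Local Notation chi b := ((-1 : R) ^+ (b : bool)).

(** Orthogonality of characters: for [u] nonzero, translation by a [z0] with [B u z0] negates the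
    sum. *)
Lemma chi_sum (u : V) : \sum_z chi (B u z) = (u == 0)%:R * s ^+ 2.
Proof.
have [->|u0] := eqVneq u 0.
  rewrite (eq_bigr (fun=> 1)) => [|z _]; last by rewrite (B0l BDl).
  by rewrite sumr_const card_V s2 mul1r.
rewrite mul0r; have [z0 Bz0] := Bnd u0; set S := \sum_z _.
suff : S = - S by move/eqP; rewrite -addr_eq0 -mulr2n mulrn_eq0 => /eqP.
rewrite {1}/S (reindex_inj (addrI z0)) /= -sumrN; apply: eq_bigr => z _.
by rewrite (BDr BDl BC) Bz0 signr_addb expr1 mulN1r.
Qed.

(** The entries of [a J + b K + c D + d S]. *)
Definition cover_fun (a b c d : R) (x y : V * bool) : R :=
  a + b * (x.1 == y.1)%:R + c * ((x.1 == y.1)%:R * (chi x.2 * chi y.2))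
    + d * (chi x.2 * chi y.2 * chi (B x.1 y.1)).

Lemma sum_delta (x : V) (F : V -> R) : \sum_z (z == x)%:R * F z = F x.
Proof.
rewrite (bigD1 x) //= eqxx mul1r big1 ?addr0 // => z /negPf ->.
by rewrite mul0r.
Qed.

(** The multiplication table is [J J = 2 s^2 J], [J K = K J = 2 J], [K K = 2 K], [D D = 2 D],
    [D S = S D = 2 S], [S S = 2 s^2 D]. A product of [J] or [K] with [D] or [S] vanishes because the
    sign cancels over the bit. *)
Lemma cover_funM a b c d a' b' c' d' x y :
  \sum_z cover_fun a b c d x z * cover_fun a' b' c' d' z y
    = cover_fun (2 * (s ^+ 2 * (a * a') + a * b' + b * a')) (2 * (b * b'))
        (2 * (c * c' + s ^+ 2 * (d * d'))) (2 * (c * d' + d * c')) x y.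
Proof.
case: x y => [x xa] [y yb].
pose t := chi xa * chi yb.
(* [G z] is the summand after summation over the bit of the middle vertex: a constant, terms
   supported at [z = x] and [z = y], and a character of [z]. *)
pose G z : R := 2 * (a * a')
  + (z == x)%:R * (2 * (b * a' + b * b' * (x == y)%:R
       + t * (c * c' * (x == y)%:R + c * d' * chi (B x y))))
  + (z == y)%:R * (2 * (a * b' + t * (d * c' * chi (B x y))))
  + 2 * t * (d * d') * chi (B (x + y) z).
transitivity (\sum_z G z).
  rewrite (eq_bigr (fun z : V * bool =>
    cover_fun a b c d (x, xa) (z.1, z.2) * cover_fun a' b' c' d' (z.1, z.2) (y, yb)));
    last by case.
  rewrite -(pair_bigA _ (fun z z2 =>
    cover_fun a b c d (x, xa) (z, z2) * cover_fun a' b' c' d' (z, z2) (y, yb))) /=.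
  apply: eq_bigr => z _; rewrite big_bool /cover_fun /G /t /= expr1 expr0.
  rewrite BDl signr_addb [z == x]eq_sym (BC y z).
  have [->|xz] := eqVneq x z; have [->|zy] := eqVneq z y; rewrite ?Bxx ?eqxx ?expr0;
    rewrite ?(negPf zy) /=.
  - by move: (chi xa) (chi yb) => u v; ring.
  - by move: (chi xa) (chi yb); case: (B _ _) => /= u v; ring.
  - by move: (chi xa) (chi yb); case: (B _ _) => /= u v; ring.
  - by move: (chi xa) (chi yb); case: (B _ _) => /= u v; ring.
rewrite /G !big_split /= sumr_const card_V -[_ *+ (2 ^ m)]mulr_natr s2.
rewrite (sum_delta x (fun=> _)) (sum_delta y (fun=> _)) -big_distrr /= chi_sum.
rewrite addv_eq0_F2 /cover_fun /= /t.
have [->|xy] := eqVneq x y; rewrite ?Bxx ?expr0 /=; ring.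
Qed.

Definition cover_mx a b c d : 'M[R]_#|T| :=
  \matrix_(i, j) cover_fun a b c d (g (enum_val i)) (g (enum_val j)).

Lemma cover_mxD a b c d a' b' c' d' :
  cover_mx a b c d + cover_mx a' b' c' d'
    = cover_mx (a + a') (b + b') (c + c') (d + d').
Proof. by apply/matrixP => i j; rewrite !mxE /cover_fun; ring. Qed.

Lemma cover_mxZ k a b c d :
  k *: cover_mx a b c d = cover_mx (k * a) (k * b) (k * c) (k * d).
Proof. by apply/matrixP => i j; rewrite !mxE /cover_fun; ring. Qed.

Lemma cover_mxM a b c d a' b' c' d' :
  cover_mx a b c d *m cover_mx a' b' c' d'
    = cover_mx (2 * (s ^+ 2 * (a * a') + a * b' + b * a')) (2 * (b * b'))
        (2 * (c * c' + s ^+ 2 * (d * d'))) (2 * (c * d' + d * c')).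
Proof.
apply/matrixP => i j; rewrite !mxE -cover_funM.
rewrite (reindex g) /=; last by exists f => x _; [apply: gK | apply: fK].
rewrite (reindex (@enum_val T (mem T))) /=; last first.
  exists enum_rank => x _; [exact: enum_valK | exact: enum_rankK].
by apply: eq_bigr => k _; rewrite !mxE.
Qed.

(** The signed entry of [S] is [chi eps] at distance 1 and [- chi eps] at distance 2, so all four
    matrices are constant on each distance class. *)
Lemma cover_fun_dist a b c d x y :
  cover_fun a b c d x y
    = [:: a + b + c + d; a + chi eps * d; a - chi eps * d; a + b - c - d]
        `_(cover_dist B eps x y).
Proof.
case: x y => [x xa] [y yb]; rewrite /cover_fun /cover_dist /=.
have [->|xy] := eqVneq x y.
  by rewrite Bxx; case: xa yb => -[] /=; ring.
by case: (B x y) (eps) xa yb => -[] [] [] /=; ring.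
Qed.

Let f_bij : bijective f. Proof. by exists g. Qed.

Lemma card_coverT : #|T| = (2 ^ m * 2)%N.
Proof. by rewrite -(bij_eq_card f_bij) card_prod card_V card_bool. Qed.

Lemma gdist_coverT x y : gdist e x y = cover_dist B eps (g x) (g y).
Proof.
by rewrite -{1}[x]gK -{1}[y]gK (gdist_iso f_bij fE) cover_gdist.
Qed.

Lemma diameter_coverT : diameter e = 3%N.
Proof. by rewrite (diameter_iso f_bij fE) cover_diameter. Qed.

Lemma in_bose_mesner_cover M :
  in_bose_mesner e M <-> exists a b c d, M = cover_mx a b c d.
Proof.
have E (a : 'I_4 -> R) : \sum_i a i *: distance_mx e R i
    = \matrix_(i, j) a (inord (gdist e (enum_val i) (enum_val j))).
  apply/matrixP => i j; rewrite summxE mxE; set d := gdist _ _ _.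
  have d_lt : (d < 4)%N by rewrite ltnS /d gdist_coverT cover_dist_le3.
  rewrite (bigD1 (inord d)) //= !mxE -/d inordK // eqxx mulr1 big1 ?addr0 //.
  move=> k kd; rewrite !mxE -/d; case: eqP => [dk|_]; last by rewrite mulr0.
  by case/eqP: kd; apply: val_inj; rewrite /= inordK.
rewrite /in_bose_mesner diameter_coverT; split=> [[a ->]|[a [b [c [d ->]]]]].
  rewrite E; pose a_ k := a (inord k).
  (* Inverse of the table of [cover_fun_dist]: distances 1 and 2 give the coefficients of [J] and
     [S], then distances 0 and 3 those of [K] and [D]. *)
  pose a1 := (a_ 1%N + a_ 2%N) / 2; pose d1 := chi eps * (a_ 1%N - a_ 2%N) / 2.
  exists a1, ((a_ 0%N + a_ 3%N) / 2 - a1), ((a_ 0%N - a_ 3%N) / 2 - d1), d1.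
  apply/matrixP => i j; rewrite !mxE gdist_coverT cover_fun_dist.
  rewrite -[a (inord _)]/(a_ _) /d1 /a1.
  have := cover_dist_le3 B eps (g (enum_val i)) (g (enum_val j)).
  by case: cover_dist => [|[|[|[|//]]]] _ /=; case: (eps) => /=; field.
pose p := [:: a + b + c + d; a + chi eps * d; a - chi eps * d; a + b - c - d].
exists (fun k => p`_k); rewrite E.
apply/matrixP => i j; rewrite !mxE gdist_coverT cover_fun_dist inordK //.
by rewrite ltnS cover_dist_le3.
Qed.

Definition cover_idempotent (j : 'I_4) : 'M[R]_#|T| :=
  [:: cover_mx (1 / (2 * s ^+ 2)) 0 0 0;
      cover_mx 0 0 (1 / 4) (1 / (4 * s));
      cover_mx (- (1 / (2 * s ^+ 2))) (1 / 2) 0 0;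
      cover_mx 0 0 (1 / 4) (- (1 / (4 * s)))]`_j.

Let s_neq0 : s != 0. Proof. by rewrite gt_eqF // (lt_trans _ s_gt1). Qed.
Let sD1_neq0 : s + 1 != 0. Proof. by rewrite gt_eqF //; move: s_gt1; lra. Qed.
Let sD2_neq0 : s + 2 != 0. Proof. by rewrite gt_eqF //; move: s_gt1; lra. Qed.

Lemma cover_idempotentM i j :
  cover_idempotent i *m cover_idempotent j
    = if i == j then cover_idempotent i else 0.
Proof.
have -> : 0 = cover_mx 0 0 0 0.
  by apply/matrixP => k l; rewrite !mxE /cover_fun !mul0r !addr0.
rewrite /cover_idempotent.
case: i j => [[|[|[|[|//]]]] ?] [[|[|[|[|//]]]] ?];
  by rewrite -val_eqE /= cover_mxM; congr cover_mx; field.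
Qed.

(** The diagonal entries are positive, because [1 < s]. *)
Lemma cover_idempotent_neq0 j : cover_idempotent j != 0.
Proof.
have T_gt0 : (0 < #|T|)%N by rewrite card_coverT muln_gt0 expn_gt0.
apply/eqP => /matrixP/(_ (Ordinal T_gt0) (Ordinal T_gt0)).
have sV : 0 < s^-1 < 1.
  by rewrite invr_gt0 invf_lt1 ?s_gt1 ?andbT ?(lt_trans _ s_gt1).
have s2V : 0 < s^-1 * s^-1 < 1.
  by case/andP: sV => h1 h2; rewrite mulr_gt0 // mulr_ilt1 // ltW.
rewrite /cover_idempotent; case: j => [[|[|[|[|//]]]] ?] /=;
  rewrite !mxE /cover_fun eqxx Bxx -!expr2 sqrr_sign !invfM /= expr0 !mulr1 => h;
  by move: sV s2V h; lra.
Qed.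

Lemma cover_idempotent_span M :
  in_bose_mesner e M
    <-> exists a : 'I_4 -> R, M = \sum_i a i *: cover_idempotent i.
Proof.
apply: iff_trans (in_bose_mesner_cover M) _.
split=> [[a [b [c [d ->]]]]|[a ->]].
  (* The coefficients are the eigenvalues on the four images: [J] has [2 s^2] on the first, [K] has
     2 on the first and third, [D] has 2 and [S] has [2 s] or [- 2 s] on the second and fourth. *)
  exists (fun i => [:: 2 * s ^+ 2 * a + 2 * b; 2 * c + 2 * s * d; 2 * b;
                       2 * c - 2 * s * d]`_i).
  rewrite !big_ord_recl big_ord0 /cover_idempotent /= addr0.
  by rewrite !cover_mxZ !cover_mxD; congr cover_mx; field.
rewrite !big_ord_recl big_ord0 /cover_idempotent /= addr0 !cover_mxZ !cover_mxD.
by do 4!eexists; reflexivity.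
Qed.

(* Interpolates the dual eigenvalues: [2 s^2 E_1] takes the four values
   [s(s+1)/2, s/2, -s/2, -s(s+1)/2], on which [2 s^2 E_2] is an even function
   and [2 s^2 E_3] an odd one. *)
Definition cover_dual_poly (j : 'I_4) : {poly R} :=
  Poly (nth [::]
    [:: [:: 1]; [:: 0; 1];
        [:: - 1 - s / (s + 2); 0; 4 / (s * (s + 2))];
        [:: 0; - 1 - 2 / ((s + 1) * (s + 2)); 0;
            8 / (s ^+ 2 * (s + 1) * (s + 2))]] j).

Lemma cover_Q_polynomial : Q_polynomial e R.
Proof.
rewrite /Q_polynomial diameter_coverT.
exists cover_idempotent, cover_dual_poly; split.
- exact: idempotent_basis_inj cover_idempotentM cover_idempotent_neq0.
- move=> M; apply: primitive_idempotent_basis.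
  + exact: cover_idempotentM.
  + exact: cover_idempotent_neq0.
  + exact: cover_idempotent_span.
- apply/matrixP => i j; rewrite !mxE /cover_fun !mul0r !addr0 div1r.
  by rewrite card_coverT natrM s2 mulrC.
move=> j; split.
  rewrite (@PolyK _ 0); first by case: j => [[|[|[|[|//]]]] ?].
  case: j => [[|[|[|[|//]]]] ?] /=.
  - exact: oner_neq0.
  - exact: oner_neq0.
  - by rewrite mulf_neq0 ?invr_eq0 ?mulf_neq0 // pnatr_eq0.
  - by rewrite mulf_neq0 ?invr_eq0 ?mulf_neq0 ?expf_neq0 // pnatr_eq0.
have -> : cover_idempotent (inord 1) = cover_mx 0 0 (1 / 4) (1 / (4 * s)).
  by rewrite /cover_idempotent inordK.
have NE : #|T|%:R = 2 * s ^+ 2 :> R by rewrite card_coverT natrM s2 mulrC.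
rewrite NE; apply/matrixP => x y; rewrite /cover_idempotent /cover_dual_poly.
rewrite [RHS]mxE horner_Poly [in RHS]mxE mxE.
(* Entries depend only on the distance, so each polynomial identity is checked at four values. *)
have := cover_dist_le3 B eps (g (enum_val x)) (g (enum_val y)).
case: j => [[|[|[|[|//]]]] ?] /=; rewrite !mxE !cover_fun_dist;
  by case: cover_dist => [|[|[|[|//]]]] _ /=; case: (eps) => /=; field;
     rewrite ?s_neq0 ?sD1_neq0 ?sD2_neq0.
Qed.
End CoverQPolynomial.

(** * Coset graphs and syndromes *)

Lemma F2_eq0D (a b : 'F_2) : (a + b != 0) = (a != 0) (+) (b != 0).
Proof. by case: a b => -[|[|//]] ? [[|[|//]] ?]. Qed.

Lemma F2E (a : 'F_2) : a = (a != 0)%:R.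
Proof. by apply: val_inj; case: a => -[|[|//]] ?. Qed.

Lemma F2_natr_neq0 k : (k%:R != 0 :> 'F_2) = odd k.
Proof. by elim: k => //= k IHk; rewrite -natr1 F2_eq0D IHk addbT. Qed.

Section CosetGraph.
Variables (N r : nat) (H : 'M['F_2]_(r, N)).
Hypothesis H_onto : forall s : 'cV_r, exists x : 'rV_N, H *m x^T = s.
Local Notation C := (code_of_parity_check H).
Local Notation vertex := {A : {set 'rV['F_2]_N} | A \in cosets C}.

Lemma translate_code (x : 'rV_N) :
  [set c + x | c in C] = [set y | H *m y^T == H *m x^T].
Proof.
apply/setP => y; rewrite inE; apply/imsetP/idP => [[c]|/eqP Hy].
  by rewrite inE => /eqP Hc ->; rewrite linearD /= mulmxDr Hc add0r.
exists (y + x); last by rewrite -addrA addvv_F2 addr0.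
by rewrite inE linearD /= mulmxDr Hy addvv_F2.
Qed.

Lemma syndrome_fiberP (s : 'cV_r) : [set y | H *m y^T == s] \in cosets C.
Proof.
have [x <-] := H_onto s; rewrite -translate_code.
by apply/imsetP; exists x.
Qed.

Definition syndrome_coset (s : 'cV_r) : vertex :=
  exist (fun A => is_true (A \in cosets C)) _ (syndrome_fiberP s).

Lemma mem_syndrome_coset s x : (x \in val (syndrome_coset s)) = (H *m x^T == s).
Proof. by rewrite inE. Qed.

Lemma syndrome_coset_bij : bijective syndrome_coset.
Proof.
have inj : injective syndrome_coset.
  move=> s t st; have [x Hx] := H_onto s; apply/eqP.
  by rewrite -Hx -mem_syndrome_coset -st mem_syndrome_coset Hx.
have onto A : exists s, syndrome_coset s == A.
  case: A => A AC; have /imsetP[x _ defA] := AC.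
  exists (H *m x^T); rewrite -val_eqE /= defA translate_code.
  by [].
exists (fun A => xchoose (onto A)) => [s|A]; last exact: (eqP (xchooseP (onto A))).
exact: inj (eqP (xchooseP (onto _))).
Qed.

Lemma card_cosets : #|cosets C| = (2 ^ r)%N.
Proof.
rewrite -card_sig -(bij_eq_card syndrome_coset_bij).
by rewrite card_mx card_Fp // muln1.
Qed.

Lemma hamming_dist1P (x y : 'rV['F_2]_N) :
  reflect (exists i, y = x + delta_mx 0 i) (hamming_dist x y == 1%N).
Proof.
apply: (iffP cards1P) => [[i /setP xyi]|[i ->]]; exists i.
  apply/rowP => j; have := xyi j; rewrite !inE !mxE eqxx /=.
  move: (x 0 j) (y 0 j) => a b; case: (j == i) => /=.
    by move=> ab; apply: val_inj; move: ab; case: a b => -[|[|//]] ? [[|[|//]] ?].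
  by move/negbFE/eqP => ->; rewrite addr0.
apply/setP => j; rewrite !inE !mxE eqxx /= -subr_eq0 opprD addNKr.
by rewrite oppr_eq0; case: (j == i).
Qed.

(** Flipping coordinate [i] of a vector adds column [i] of [H] to its syndrome, so the coset graph
    is the Cayley graph of the syndrome space with respect to the columns. *)
Lemma coset_graph_syndrome (s t : 'cV_r) :
  coset_graph C (syndrome_coset s) (syndrome_coset t)
    = [exists i, col i H == s + t].
Proof.
apply/existsP/existsP => [[x /andP[xs /existsP[y /andP[yt]]]]|[i /eqP Hi]].
  move/hamming_dist1P => [i def_y]; exists i.
  move: xs yt; rewrite !mem_syndrome_coset => /eqP <- /eqP <-.
  by rewrite def_y linearD /= trmx_delta mulmxDr -colE addKv_F2.
have [x Hx] := H_onto s.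
exists x; rewrite mem_syndrome_coset Hx eqxx; apply/existsP.
exists (x + delta_mx 0 i); rewrite mem_syndrome_coset linearD /= trmx_delta.
rewrite mulmxDr -colE Hx Hi addKv_F2 eqxx.
by apply/hamming_dist1P; exists i.
Qed.
End CosetGraph.

(** * A parity check matrix for the extended code *)

Section ExtendedCode.
Variables (N r : nat) (H : 'M['F_2]_(r, N)).

Definition extended_parity_check : 'M['F_2]_(r + 1, N + 1) :=
  block_mx H 0 (const_mx 1) 1%:M.

Lemma extended_parity_checkM (x : 'rV_N) (p : 'M_1) :
  extended_parity_check *m (row_mx x p)^T
    = col_mx (H *m x^T) ((\sum_i x 0 i)%:M + p).
Proof.
rewrite tr_row_mx mul_block_col mul0mx addr0 mul1mx; congr col_mx.
congr (_ + _); apply/matrixP => i j; rewrite !ord1 !mxE ?mulr1n //.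
by apply: eq_bigr => k _; rewrite !mxE mul1r.
Qed.

Lemma extended_codeE :
  extended_code (code_of_parity_check H)
    = code_of_parity_check extended_parity_check.
Proof.
apply/setP => y; rewrite inE -[y]hsubmxK extended_parity_checkM col_mx_eq0.
rewrite addv_eq0_F2; apply/imsetP/andP => [[c]|[Hc /eqP defp]].
  by rewrite inE => Hc /eq_row_mx[-> ->].
by exists (lsubmx y); rewrite ?inE ?Hc ?defp.
Qed.

Lemma extended_parity_check_onto :
  (forall s : 'cV_r, exists x : 'rV_N, H *m x^T = s) ->
  forall s : 'cV_(r + 1), exists x : 'rV_(N + 1), extended_parity_check *m x^T = s.
Proof.
move=> onto s; have [x Hx] := onto (usubmx s).
exists (row_mx x ((\sum_i x 0 i)%:M + dsubmx s)).
by rewrite extended_parity_checkM Hx addKv_F2 vsubmxK.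
Qed.
End ExtendedCode.

(** * Powers of a primitive element and weights modulo 4 *)

Section PrimitivePowers.
Variables (m : nat) (L : fieldExtType 'F_2) (alpha : L).
Hypothesis dimL : \dim {:L}%VS = m.
Hypothesis alpha_prim : (2 ^ m - 1)%N.-primitive_root alpha.

Let n_gt0 : (0 < 2 ^ m - 1)%N. Proof. exact: prim_order_gt0 alpha_prim. Qed.

Lemma alpha_neq0 : alpha != 0.
Proof. by rewrite (prim_root_eq0 alpha_prim) -lt0n. Qed.

Lemma alpha_exp_inj (i j : 'I_(2 ^ m - 1)) : alpha ^+ i = alpha ^+ j -> i = j.
Proof.
move/eqP; rewrite (eq_prim_root_expr alpha_prim) !modn_small // => /eqP.
exact: val_inj.
Qed.

(* [<<1; alpha>>] contains [0] and [2 ^ m - 1] distinct powers, so it is everything. *)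
Lemma adjoin_alpha_full : <<1; alpha>>%VS = fullv.
Proof.
pose U : {vspace finvect_type L} := <<1; alpha>>%VS.
pose h (i : 'I_(2 ^ m - 1)) : finvect_type L := alpha ^+ i.
have h_inj : injective h by move=> i j; apply: alpha_exp_inj.
apply/eqP; rewrite eqEdim subvf dimL.
have cardU : #|U| = (2 ^ \dim <<1; alpha>>)%N by rewrite card_vspace card_Fp.
rewrite -(@leq_exp2l 2) // -cardU.
have <- : #|0%R |: [set h i | i : 'I_(2 ^ m - 1)]| = (2 ^ m)%N.
  rewrite cardsU1 card_imset // card_ord; case: imsetP => [[i _ /esym/eqP]|_].
    by rewrite expf_eq0 (negPf alpha_neq0) andbF.
  by rewrite add1n subn1 prednK // expn_gt0.
apply/subset_leq_card/subsetP => y; rewrite !inE => /orP[/eqP->|/imsetP[i _ ->]].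
  exact: mem0v.
by apply: rpredX; apply: memv_adjoin.
Qed.

(** As [alpha] generates [L], its degree is [m] and every element is a polynomial in [alpha] of
    degree below [m]; [m] spanning vectors in dimension [m] form a basis. *)
Lemma power_basis_full : basis_of fullv (power_basis m alpha).
Proof.
rewrite basisEdim size_tuple dimL leqnn andbT; apply/subvP => y _.
have deg : adjoin_degree 1%AS alpha = m.
  have := dim_Fadjoin 1%AS alpha.
  by rewrite adjoin_alpha_full dimL dimv1 muln1.
have yU : y \in <<1%AS; alpha>>%VS by rewrite adjoin_alpha_full memvf.
rewrite -(Fadjoin_poly_eq yU); set p := Fadjoin_poly _ _ _.
have sp : (size p <= m)%N by rewrite -deg size_Fadjoin_poly.
rewrite (horner_coef_wide _ sp); apply: rpred_sum => i _.
have /vlineP[k ->] : p`_i \in 1%VS by apply/polyOverP/Fadjoin_polyOver.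
rewrite -scalerAl mul1r rpredZ // memv_span //.
by apply/mapP; exists i; rewrite // mem_enum.
Qed.

(** The columns are nonzero and pairwise distinct, and there are as many of them as nonzero
    vectors. *)
Lemma hamming_mx_col (h : 'cV_m) :
  (exists i, col i (hamming_mx m alpha) = h) <-> h != 0.
Proof.
have coord_inj (y z : L) :
    (forall r, coord (power_basis m alpha) r y = coord (power_basis m alpha) r z) ->
    y = z.
  move=> yz; rewrite (coord_basis power_basis_full (memvf y)).
  rewrite (coord_basis power_basis_full (memvf z)).
  by apply: eq_bigr => r _; rewrite yz.
have col_inj : injective (fun i => col i (hamming_mx m alpha)).
  move=> i j /matrixP ij; apply/alpha_exp_inj/coord_inj => r.
  by have := ij r 0; rewrite !mxE.
have col_neq0 i : col i (hamming_mx m alpha) != 0.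
  apply: contra_neq (expf_neq0 i alpha_neq0) => /matrixP c0.
  by apply: coord_inj => r; have := c0 r 0; rewrite !mxE linear0.
split=> [[i <-]//|h0].
have : [set col i (hamming_mx m alpha) | i : 'I_(2 ^ m - 1)] == ~: [set 0].
  rewrite eqEcard cardsC1 card_V card_imset // card_ord -subn1 leqnn andbT.
  by apply/subsetP => _ /imsetP[i _ ->]; rewrite !inE.
move/eqP/setP/(_ h); rewrite !inE h0 => /imsetP[i _ ->].
by exists i.
Qed.
End PrimitivePowers.

(** * Weights modulo 4 and their polar form *)

Section WeightForm.
Variable m : nat.
Local Notation V := 'cV['F_2]_m.
Implicit Types x y z : V.

Definition weight x : nat := #|[set r | x r 0 != 0]|.

Definition overlap x y : nat := #|[set r | (x r 0 != 0) && (y r 0 != 0)]|.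

(* The polar form of the second elementary symmetric polynomial. *)
Definition weight_form x y : bool :=
  (\sum_r x r 0) * (\sum_r y r 0) + \sum_r x r 0 * y r 0 != 0.

Lemma weight_sum x : \sum_r x r 0 = (weight x)%:R.
Proof.
rewrite /weight -sum1_card natr_sum [RHS]big_mkcond /=; apply: eq_bigr => r _.
by rewrite {1}[x r 0]F2E inE; case: ifP.
Qed.

Lemma overlap_sum x y : \sum_r x r 0 * y r 0 = (overlap x y)%:R.
Proof.
rewrite /overlap -sum1_card natr_sum [RHS]big_mkcond /=; apply: eq_bigr => r _.
by rewrite {1}[x r 0]F2E {1}[y r 0]F2E inE -natrM mulnb; case: (_ && _).
Qed.

Lemma weight_formE x y :
  weight_form x y = odd (weight x * weight y + overlap x y).
Proof.
by rewrite /weight_form !weight_sum overlap_sum -natrM -natrD F2_natr_neq0.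
Qed.

Lemma weightD x y : (weight (x + y) + (overlap x y).*2 = weight x + weight y)%N.
Proof.
have cardE (P : pred 'I_m) : #|[set r | P r]| = (\sum_r P r)%N.
  rewrite -sum1_card big_mkcond; apply: eq_bigr => r _; rewrite inE.
  by case: ifP.
rewrite /weight /overlap !cardE -addnn -!big_split; apply: eq_bigr => r _ /=.
by rewrite !mxE F2_eq0D; case: (x r 0 != 0); case: (y r 0 != 0).
Qed.

Lemma weight_formDl x y z :
  weight_form (x + y) z = weight_form x z (+) weight_form y z.
Proof.
rewrite /weight_form -F2_eq0D.
under eq_bigr do rewrite mxE.
under [\sum_r (x + y) r 0 * z r 0]eq_bigr do rewrite mxE mulrDl.
rewrite !big_split /= mulrDl; congr (_ != 0).
by rewrite !addrA; congr (_ + _); rewrite addrAC.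
Qed.

Lemma weight_formC x y : weight_form x y = weight_form y x.
Proof.
rewrite /weight_form mulrC; congr (_ + _ != 0).
by apply: eq_bigr => r _; rewrite mulrC.
Qed.

Lemma weight_formxx x : weight_form x x = false.
Proof.
have -> : weight_form x x = odd (weight x * weight x + weight x).
  rewrite weight_formE; congr (odd (_ + _)).
  by apply: eq_card => r; rewrite !inE andbb.
by rewrite oddD oddM; case: odd.
Qed.

(** Pairing with a unit vector gives the coordinate sum of [x] plus one coordinate. If all these
    vanish, every coordinate equals the sum, which is [m] times a coordinate, hence 0 for even
    [m]. *)
Lemma weight_form_nondegenerate x :
  ~~ odd m -> x != 0 -> exists y, weight_form x y.
Proof.
move=> m_even x0; apply/existsP; apply: contraR x0 => /existsPn x_orth.
have xE r : x r 0 = \sum_s x s 0.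
  have /negbNE := x_orth (delta_mx r 0); rewrite addr_eq0.
  have -> : \sum_s (delta_mx r 0 : V) s 0 = 1.
    rewrite (bigD1 r) //= mxE !eqxx big1 ?addr0 // => s /negPf sr.
    by rewrite mxE sr.
  have -> : \sum_s x s 0 * (delta_mx r 0 : V) s 0 = x r 0.
    rewrite (bigD1 r) //= mxE !eqxx mulr1 big1 ?addr0 // => s /negPf sr.
    by rewrite mxE sr mulr0.
  rewrite mulr1 => /eqP ->.
  by apply: val_inj; case: (x r 0) => -[|[|//]] ?.
apply/eqP/matrixP => r j; rewrite ord1 mxE xE.
rewrite (eq_bigr (fun=> x r 0)) => [|s _]; last by rewrite !xE.
rewrite sumr_const card_ord -mulr_natr.
by move: (F2_natr_neq0 m); rewrite (negPf m_even) => /negbFE/eqP ->; rewrite mulr0.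
Qed.

Definition weight_class (i1 i2 : nat) x : bool :=
  (weight x == i1 %[mod 4]) || (weight x == i2 %[mod 4]).

(** Both sides depend only on the two weights and the overlap modulo 4, which leaves a finite
    check. *)
Lemma weight_class_polar (i1 i2 : nat) (eps : bool) x y :
  (i1, i2, eps) \in [:: (0, 1, true); (1, 2, false)]%N ->
  weight_class i1 i2 (x + y)
    = weight_class i1 i2 x (+) weight_class i1 i2 y (+) weight_form x y (+) eps.
Proof.
rewrite weight_formE /weight_class => i12; have := weightD x y.
move: (weight (x + y)) (weight x) (weight y) (overlap x y) => d a b c dE.
(* Modulo 4 the term [2 c] may change sides without changing sign. *)
have {}dE : (d %% 4 = (a %% 4 + b %% 4 + (c %% 4).*2) %% 4)%N.
  rewrite -muln2 -[RHS]modnDml modnDm -[RHS]modnDm modn_mod modnMml modnDm -dE.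
  by rewrite -addnA -muln2 -mulnDr -[(2 + 2)%N]/4%N -modnDmr modnMl addn0.
rewrite dE oddD oddM -[odd a](odd_mod a (d := 4)) // -[odd b](odd_mod b (d := 4)) //.
rewrite -[odd c](odd_mod c (d := 4)) //.
have := ltn_pmod a (isT : (0 < 4)%N); have := ltn_pmod b (isT : (0 < 4)%N).
have := ltn_pmod c (isT : (0 < 4)%N).
move: (a %% 4)%N (b %% 4)%N (c %% 4)%N => {dE}a' b' c'.
move: i12; rewrite !inE => /orP[]/eqP[-> -> ->];
by case: a' => [|[|[|[|//]]]]; case: b' => [|[|[|[|//]]]]; case: c' => [|[|[|[|//]]]].
Qed.
End WeightForm.

(** * Identification of the coset graphs with the two models *)

Section HammingCosetGraphs.
Variables (m : nat) (L : fieldExtType 'F_2) (alpha : L).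
Hypothesis m_ge4 : (4 <= m)%N.
Hypothesis m_even : ~~ odd m.
Hypothesis dimL : \dim {:L}%VS = m.
Hypothesis alpha_prim : (2 ^ m - 1)%N.-primitive_root alpha.
Local Notation V := 'cV['F_2]_m.
Local Notation form := (@weight_form m).
Local Notation n := (2 ^ m - 1)%N.

Let Bnd (x : V) : x != 0 -> exists y, form x y.
Proof. exact: weight_form_nondegenerate. Qed.

Definition bit_col k (x : 'cV['F_2]_k) (b : bool) : 'cV['F_2]_(k + 1) :=
  col_mx x b%:R%:M.

Lemma bit_colD k (x y : 'cV_k) b c :
  bit_col x b + bit_col y c = bit_col (x + y) (b (+) c).
Proof.
rewrite /bit_col add_col_mx -raddfD; congr (col_mx _ _%:M).
by apply: val_inj; case: b c => -[].
Qed.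

Lemma bit_col_inj k (x y : 'cV_k) b c :
  bit_col x b = bit_col y c -> x = y /\ b = c.
Proof.
case/eq_col_mx => -> /matrixP/(_ 0 0); rewrite !mxE.
by case: b c => -[].
Qed.

Lemma bit_colK k (s : 'cV_(k + 1)) : bit_col (usubmx s) (dsubmx s 0 0 != 0) = s.
Proof. by rewrite /bit_col -F2E -mx11_scalar vsubmxK. Qed.

Lemma bit_col0 k : bit_col (0 : 'cV_k) false = 0.
Proof. by rewrite /bit_col /= raddf0 col_mx0. Qed.

Section Classes.
Variables (i1 i2 : nat) (eps : bool).
Hypothesis i12 : (i1, i2, eps) \in [:: (0, 1, true); (1, 2, false)]%N.
Local Notation wc := (@weight_class m i1 i2).
Local Notation H := (col_mx (hamming_mx m alpha) (v_row m alpha i1 i2)).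

Let polar (x y : V) : wc (x + y) = wc x (+) wc y (+) form x y (+) eps.
Proof. exact: weight_class_polar. Qed.

Lemma col_parity i :
  col i H = bit_col (col i (hamming_mx m alpha)) (wc (col i (hamming_mx m alpha))).
Proof.
rewrite col_col_mx; congr col_mx; apply/matrixP => r c; rewrite !ord1 !mxE mulr1n.
have -> : col_weight (L := L) alpha i = weight (col i (hamming_mx m alpha)).
  by apply: eq_card => j; rewrite !inE !mxE.
by [].
Qed.

Lemma col_parityP (x : V) (b : bool) :
  reflect (x != 0 /\ b = wc x) [exists i, col i H == bit_col x b].
Proof.
apply: (iffP existsP) => [[i]|[x0 ->]].
  rewrite col_parity => /eqP/bit_col_inj[<- <-]; split=> //.
  by apply/(hamming_mx_col dimL alpha_prim); exists i.
have /(hamming_mx_col dimL alpha_prim)[i <-] := x0.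
by exists i; rewrite col_parity.
Qed.

(** The syndromes form a subgroup containing the columns. It contains [(0, 1)]: the columns of [h],
    [h'] and [h + h'] sum to it when [weight_form h h'] equals [~~ eps]. *)
Lemma parity_onto (s : 'cV_(m + 1)) : exists x : 'rV_n, H *m x^T = s.
Proof.
pose P t := exists x : 'rV_n, H *m x^T = t.
have PD t t' : P t -> P t' -> P (t + t').
  by move=> [x <-] [x' <-]; exists (x + x'); rewrite linearD /= mulmxDr.
have P0 : P 0 by exists 0; rewrite trmx0 mulmx0.
have Pcol h : h != 0 -> P (bit_col h (wc h)).
  move=> h0; have /existsP[i /eqP <-] : [exists i, col i H == bit_col h (wc h)].
    exact/col_parityP.
  by exists (delta_mx 0 i); rewrite trmx_delta -colE.
have [h h0] : exists h : V, h != 0.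
  suff /card_gt0P[h] : (0 < #|~: [set 0%R : V]|)%N by rewrite !inE; exists h.
  by rewrite cardsC1 card_V; have := expn2_ge16 m_ge4; case: (2 ^ m)%N => [|[]].
have P1 : P (bit_col 0 true).
  have : (0 < cover_kappa m eps)%N by apply: cover_kappa_gt0.
  rewrite -(cover_kappaE (@weight_formDl m) (@weight_formC m) (@weight_formxx m)
              Bnd eps h0).
  case/card_gt0P => h'; rewrite inE => /andP[/andP[h'0 h'h] /eqP Bh].
  have hh' : h + h' != 0 by rewrite addv_eq0_F2 eq_sym.
  have := PD _ _ (PD _ _ (Pcol h h0) (Pcol h' h'0)) (Pcol _ hh').
  rewrite !bit_colD addvv_F2 polar Bh.
  by case: (wc h) (wc h') (eps) => -[] [].
rewrite -[s]bit_colK; move: (usubmx s) (_ != 0) => x b.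
(* The extra term cancels the bit at [x = 0], where the zero vector stands in for the missing
   column. *)
have Px : P (bit_col x (wc x (+) (x == 0) && wc x)).
  have [->|x0] := eqVneq x 0; last by rewrite addbF; apply: Pcol.
  by rewrite addbb bit_col0.
case: (eqVneq b (wc x (+) (x == 0) && wc x)) => [-> //|bx].
have := PD _ _ Px P1; rewrite bit_colD addr0.
suff -> : wc x (+) (x == 0) && wc x (+) true = b by [].
by move: bx; case: b; case: (_ (+) _).
Qed.

Definition twist (p : V * bool) : 'cV['F_2]_(m + 1) := bit_col p.1 (p.2 (+) wc p.1).

Lemma twist_bij : bijective twist.
Proof.
exists (fun s => (usubmx s, (dsubmx s 0 0 != 0) (+) wc (usubmx s))) => [[x b]|s].
  rewrite /twist /= /bit_col col_mxKu col_mxKd mxE mulr1n; congr pair.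
  by case: b (wc x) => -[].
by rewrite /twist /= -addbA addbb addbF bit_colK.
Qed.

Definition twist_coset (p : V * bool) := syndrome_coset parity_onto (twist p).

Lemma twist_coset_bij : bijective twist_coset.
Proof. exact: bij_comp (syndrome_coset_bij _) twist_bij. Qed.

(** By polarisation, the twist turns the condition that the bit of the syndrome difference be
    [wc (x + y)] into [a + b = B(x, y) + eps]. *)
Lemma twist_coset_edge p q :
  Gamma m alpha i1 i2 (twist_coset p) (twist_coset q) = cover_edge form eps p q.
Proof.
case: p q => [x a] [y b]; rewrite /Gamma coset_graph_syndrome bit_colD /=.
rewrite /cover_edge /= -addv_eq0_F2.
apply/col_parityP/andP => [[-> ab]|[-> /eqP ab]]; split=> //.
  apply/eqP; move: ab; rewrite polar.
  by case: (wc x) (wc y) (form x y) (eps) (a) (b) => -[] [] [] [] [].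
move: ab; rewrite polar.
by case: (wc x) (wc y) (form x y) (eps) (a) (b) => -[] [] [] [] [].
Qed.

Lemma Gamma_card : #|cosets (code_C m alpha i1 i2)| = (2 ^ (m + 1))%N.
Proof. exact: card_cosets parity_onto. Qed.

Lemma Gamma_symmetry :
  [/\ imprimitive (Gamma m alpha i1 i2), antipodal (Gamma m alpha i1 i2)
    & distance_transitive (Gamma m alpha i1 i2)].
Proof.
split.
- apply: imprimitive_iso twist_coset_bij twist_coset_edge _.
  by apply: cover_imprimitive => //;
    [apply: weight_formDl | apply: weight_formC | apply: weight_formxx].
- apply: antipodal_iso twist_coset_bij twist_coset_edge _.
  by apply: cover_antipodal => //;
    [apply: weight_formDl | apply: weight_formC | apply: weight_formxx].
- apply: distance_transitive_iso twist_coset_bij twist_coset_edge _.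
  by apply: cover_distance_transitive => //;
    [apply: weight_formDl | apply: weight_formC | apply: weight_formxx].
Qed.

Lemma Gamma_distance_regular :
  distance_regular_with (Gamma m alpha i1 i2)
    [:: n; cover_kappa m eps; 1%N] [:: 1%N; cover_kappa m eps; n].
Proof.
apply: distance_regular_with_iso twist_coset_bij twist_coset_edge _ _ _.
by apply: cover_distance_regular => //;
  [apply: weight_formDl | apply: weight_formC | apply: weight_formxx].
Qed.

Lemma Gamma_Q_polynomial (R : realFieldType) : Q_polynomial (Gamma m alpha i1 i2) R.
Proof.
have [g fK gK] := twist_coset_bij.
(* For even [m] the required square root of [2 ^ m] is [2 ^ m./2]. *)
apply: (cover_Q_polynomial (@weight_formDl m) (@weight_formC m) (@weight_formxx m)
          Bnd m_ge4 fK gK twist_coset_edge (s := (2 ^ m./2)%:R)).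
  by rewrite ltr1n -{1}(expn0 2) ltn_exp2l // half_gt0; apply: leq_trans m_ge4.
by rewrite -natrX -expnM muln2 even_halfK.
Qed.
End Classes.

Local Notation H := (col_mx (hamming_mx m alpha) (v_row m alpha 1 2)).
Local Notation wc := (@weight_class m 1 2).
Let i12 : (1, 2, false)%N \in [:: (0, 1, true); (1, 2, false)]%N. Proof. by []. Qed.

Lemma extended_parity_onto (s : 'cV_(m + 1 + 1)) :
  exists x : 'rV_(n + 1), extended_parity_check H *m x^T = s.
Proof. exact/extended_parity_check_onto/(parity_onto i12). Qed.

(** The column of the added coordinate is the case [x = 0], as [wc 0] is false for the classes 1 and
    2. All vectors [x] then occur, so adjacency has no condition [x != y]. *)
Lemma extended_colP (x : V) (b c : bool) :
  reflect (c /\ b = wc x)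
    [exists i, col i (extended_parity_check H) == bit_col (bit_col x b) c].
Proof.
have const1 (i : 'I_n) : col i (const_mx 1 : 'rV['F_2]_n) = true%:R%:M.
  by apply/matrixP => j k; rewrite !ord1 !mxE.
have wc0 : wc 0 = false.
  suff w0 : weight (0 : V) = 0%N by rewrite /weight_class w0.
  by apply: eq_card0 => r; rewrite !inE mxE eqxx.
apply: (iffP existsP) => [[i]|[-> ->]].
  rewrite /extended_parity_check block_mxEh -[i]splitK; case: (split i) => j /=.
    rewrite colKl col_col_mx const1 => /eqP/(@bit_col_inj _ _ _ true)[].
    rewrite (col_parity 1 2) => /bit_col_inj[<- <-] <-.
    by [].
  rewrite colKr col_col_mx col0 ord1 col_id => /eqP.
  rewrite -bit_col0 => /(@bit_col_inj _ _ _ true)[/bit_col_inj[<- <-] <-].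
  by rewrite wc0.
have [->|x0] := eqVneq x 0.
  exists (rshift n ord0); rewrite /extended_parity_check block_mxEh colKr.
  by rewrite col_col_mx col0 col_id wc0 bit_col0.
have /existsP[i /eqP Hi] : [exists i, col i H == bit_col x (wc x)].
  exact/col_parityP.
exists (lshift 1 i); rewrite /extended_parity_check block_mxEh colKl.
by rewrite col_col_mx Hi const1.
Qed.

Definition twist_star (p : V * bool * bool) : 'cV['F_2]_(m + 1 + 1) :=
  bit_col (twist 1 2 p.1) p.2.

Lemma twist_star_bij : bijective twist_star.
Proof.
have [g fK gK] := twist_bij 1 2.
exists (fun s => (g (usubmx s), dsubmx s 0 0 != 0)) => [[p b]|s].
  by rewrite /twist_star /bit_col col_mxKu col_mxKd fK mxE mulr1n; case: b.
by rewrite /twist_star /= gK bit_colK.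
Qed.

Definition twist_star_coset (p : V * bool * bool) :=
  syndrome_coset extended_parity_onto (twist_star p).

Lemma twist_star_coset_bij : bijective twist_star_coset.
Proof. exact: bij_comp (syndrome_coset_bij _) twist_star_bij. Qed.

Lemma twist_star_coset_edge p q :
  coset_graph (code_of_parity_check (extended_parity_check H))
    (twist_star_coset p) (twist_star_coset q) = hadamard_edge form p q.
Proof.
case: p q => [[x a] p] [[y b] q]; rewrite coset_graph_syndrome !bit_colD /=.
have polar : wc (x + y) = wc x (+) wc y (+) form x y.
  by rewrite (weight_class_polar _ _ i12) addbF.
rewrite /hadamard_edge /= -negb_add negbK.
apply/extended_colP/andP => [[-> ab]|[-> /eqP ab]]; split=> //.
  apply/eqP; move: ab; rewrite polar.
  by case: (wc x) (wc y) (form x y) (a) (b) => -[] [] [] [].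
move: ab; rewrite polar.
by case: (wc x) (wc y) (form x y) (a) (b) => -[] [] [] [].
Qed.

Lemma Gamma_star_card : #|cosets (code_Cstar m alpha 1 2)| = (2 ^ (m + 2))%N.
Proof.
by rewrite /code_Cstar extended_codeE (card_cosets extended_parity_onto) -addnA.
Qed.

Lemma Gamma_star_properties :
  [/\ imprimitive (Gamma_star m alpha 1 2), antipodal (Gamma_star m alpha 1 2),
      distance_transitive (Gamma_star m alpha 1 2)
    & distance_regular_with (Gamma_star m alpha 1 2)
        [:: (2 ^ m)%N; n; (2 ^ m)./2; 1%N] [:: 1%N; (2 ^ m)./2; n; (2 ^ m)%N]].
Proof.
rewrite /Gamma_star /code_Cstar extended_codeE.
split.
- apply: imprimitive_iso twist_star_coset_bij twist_star_coset_edge _.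
  by apply: hadamard_imprimitive => //;
    [apply: weight_formDl | apply: weight_formC | apply: weight_formxx].
- apply: antipodal_iso twist_star_coset_bij twist_star_coset_edge _.
  by apply: hadamard_antipodal => //;
    [apply: weight_formDl | apply: weight_formC | apply: weight_formxx].
- apply: distance_transitive_iso twist_star_coset_bij twist_star_coset_edge _.
  by apply: hadamard_distance_transitive => //;
    [apply: weight_formDl | apply: weight_formC | apply: weight_formxx].
- apply: distance_regular_with_iso twist_star_coset_bij twist_star_coset_edge _ _ _.
  by apply: hadamard_distance_regular => //;
    [apply: weight_formDl | apply: weight_formC | apply: weight_formxx].
Qed.
End HammingCosetGraphs.

Theorem theorem3p1 (R : realType) (m : nat) (m_ge4 : (4 <= m)%N)
    (m_even : ~~ odd m) (L : fieldExtType 'F_2) (dimL : \dim {:L}%VS = m)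
    (alpha : L) (alpha_prim : ((2 ^ m - 1)%N.-primitive_root alpha)%R) :
  let n := (2 ^ m - 1)%N in
  let G01 := Gamma m alpha 0 1 in
  let G12 := Gamma m alpha 1 2 in
  let Gs12 := Gamma_star m alpha 1 2 in
  [/\ [/\ #|cosets (code_C m alpha 0 1)| = (2 ^ (m + 1))%N,
          #|cosets (code_C m alpha 1 2)| = (2 ^ (m + 1))%N &
          #|cosets (code_Cstar m alpha 1 2)| = (2 ^ (m + 2))%N],
      [/\ imprimitive G01, antipodal G01 & distance_transitive G01],
      [/\ imprimitive G12, antipodal G12 & distance_transitive G12],
      [/\ imprimitive Gs12, antipodal Gs12 & distance_transitive Gs12] &
      [/\ distance_regular_with G01
            [:: n; (n - 3) %/ 2; 1]%N [:: 1; (n - 3) %/ 2; n]%N,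
          distance_regular_with G12
            [:: n; (n + 1) %/ 2; 1]%N [:: 1; (n + 1) %/ 2; n]%N,
          distance_regular_with Gs12
            [:: n + 1; n; (n + 1) %/ 2; 1]%N [:: 1; (n + 1) %/ 2; n; n + 1]%N,
          Q_polynomial G01 R &
          Q_polynomial G12 R]].
Proof.
move=> n G01 G12 Gs12.
have n1 : (n + 1 = 2 ^ m)%N by rewrite subnK // expn_gt0.
have k12 : ((n + 1) %/ 2 = (2 ^ m)./2)%N by rewrite n1 divn2.
have k12' : ((n + 1) %/ 2)%N = cover_kappa m false.
  by rewrite k12 /cover_kappa subn0.
(* [2 ^ m - 4] is twice [2 ^ (m - 1) - 2]. *)
have k01 : ((n - 3) %/ 2)%N = cover_kappa m true.
  rewrite divn2 /cover_kappa /n -subnDA; case: (m) m_ge4 => // m' _.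
  by rewrite expnS mul2n doubleK -[(1 + 3)%N]/(2.*2)%N -doubleB doubleK.
have in01 : (0, 1, true)%N \in [:: (0, 1, true); (1, 2, false)]%N by [].
have in12 : (1, 2, false)%N \in [:: (0, 1, true); (1, 2, false)]%N by [].
have [imp ant dt dr] := Gamma_star_properties m_ge4 m_even dimL alpha_prim.
split.
- split; [exact: (Gamma_card m_ge4 m_even dimL alpha_prim in01)
         | exact: (Gamma_card m_ge4 m_even dimL alpha_prim in12)
         | exact: Gamma_star_card].
- exact: (Gamma_symmetry m_ge4 m_even dimL alpha_prim in01).
- exact: (Gamma_symmetry m_ge4 m_even dimL alpha_prim in12).
- by [].
- split.
  + rewrite k01.
    exact: (Gamma_distance_regular m_ge4 m_even dimL alpha_prim in01).
  + rewrite k12'.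
    exact: (Gamma_distance_regular m_ge4 m_even dimL alpha_prim in12).
  + suff dr_eq k : k = (2 ^ m)%N ->
        distance_regular_with Gs12 [:: k; n; (2 ^ m)./2; 1%N] [:: 1%N; (2 ^ m)./2; n; k].
      by rewrite k12; apply: dr_eq.
    by move=> ->.
  + exact: (Gamma_Q_polynomial m_ge4 m_even dimL alpha_prim in01).
  + exact: (Gamma_Q_polynomial m_ge4 m_even dimL alpha_prim in12).
Qed.
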